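(* Let $p$ be any prime and let $G\le\operatorname{Aut}T$ be a regular branch Šunić group acting on the $p$-adic tree $T$. Let $r_G$ denote the number of directed automorphisms in a standard generating system for $G$. For $p=2$, let $K=\langle[a,b_2],\dots,[a,b_{r_G}]\rangle^G$ and let $n_G$ be a positive integer $n$ such that $\langle a,b_1,\dots,b_{r_G-1}\rangle\subseteq\varphi_{u_n}(\mathrm{st}_K(u_n))$, where $u_n=2\overset{n}{\cdots}2$ is the rightmost vertex at level $n$. Then the normal rank of $G$ and the central width of its congruence completion $\overline{G}$ are bounded as follows: $$\operatorname{rk}^{\trianglelefteq}(G),\; w_{\mathrm{cen}}(\overline{G})\le\begin{cases} r_G+3&\text{if $p$ is odd},\\ r_G+n_G+3&\text{if }p=2.\end{cases}$$
   Context: **Normal rank and central width.** For a group $G$ and $N\trianglelefteq G$, $d_G^{\trianglelefteq}(N)$ is the minimal number of normal generators of $N$ in $G$, and $\operatorname{rk}^{\trianglelefteq}(G)=\sup\{d_G^{\trianglelefteq}(N)\mid N\trianglelefteq G\text{ with }d_G^{\trianglelefteq}(N)<\infty\}$. For a pro-$p$ group $\Gamma$, $w_{\mathrm{cen}}(\Gamma)=\sup\{\log_p|\Delta:[\Delta,\Gamma]|\mid\Delta\trianglelefteq\Gamma\text{ open normal}\}\in\mathbb{N}_0\cup\{\infty\}$, with $[\Delta,\Gamma]$ understood as a closed subgroup. **Tree and automorphisms.** $T$ is the infinite rooted tree whose vertices are the finite words over $X=\{1,\dots,p\}$ (root: the empty word), with an edge between $u$ and $ux$ for every word $u$ and $x\in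 X$; level $n$ consists of the words of length $n$. $\operatorname{Aut} T$ acts on the right, $u\mapsto u^f$. The section $f_u\in\operatorname{Aut}T$ of $f$ at $u$ is given by $(uv)^f=u^fv^{f_u}$ for all words $v$. For $G\le\operatorname{Aut}T$, $\mathrm{st}_G(u)$ is the stabiliser of the vertex $u$ and $\operatorname{St}_G(n)=\bigcap_{|v|=n}\mathrm{st}_G(v)$. For a vertex $u$, $\varphi_u\colon\mathrm{st}_{\operatorname{Aut}T}(u)\to\operatorname{Aut}T$, $f\mapsto f_u$. The map $\psi\colon\operatorname{St}_{\operatorname{Aut}T}(1)\to\operatorname{Aut}T\times\overset{p}{\cdots}\times\operatorname{Aut}T$ is $g\mapsto(g_1,\dots,g_p)$, the sections at the vertices $1,\dots,p$. $\operatorname{Aut}T$ is a profinite group with the subgroups $\operatorname{St}_{\operatorname{Aut}T}(n)$ as a base of neighbourhoods of the identity; the congruence completion $\overline{G}$ is the closure of $G$ in $\operatorname{Aut}T$. **Regular branch.** $G$ is self-similar if $\varphi_u(\mathrm{st}_G(u))\subseteq G$ for every vertex $u$. $G$ is regular branch over a finite-index subgroup $L\le G$ if $G$ acts transitively on every level of $T$, $G$ is self-similar, and $L\times\overset{p}{\cdots}\times L\subseteq\psi(\operatorname{St}_L(1))$; $G$ is regular branch if this holds for some such $L$. **Šunić groups.** Let $r\in\mathbb{N}$ and let $f(x)=x^r+\alpha_{r-1}x^{r-1}+\dots+\alpha_1x+\alpha_0\in\mathbb{F}_p[x]$ with $\alpha_0\ne0$. The Šunić group $G=G_{p,f}$ is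 generated by the rooted automorphism $a$, $(xv)^a=x^{\sigma}v$ with $\sigma=(1\,2\,\cdots\,p)$, and the directed automorphisms $b_1,\dots,b_r$ defined by $$\psi(b_i)=(1,\dots,1,b_{i+1})\ (1\le i\le r-1),\qquad \psi(b_r)=(a,1,\dots,1,b_1^{-\alpha_0}b_2^{-\alpha_1}\cdots b_r^{-\alpha_{r-1}}).$$ The set $\{a,b_1,\dots,b_r\}$ is a standard generating system, and $r_G=r$. For $H\subseteq G$, $\langle H\rangle^G$ denotes the normal closure in $G$. *)

(* Defs.v *)
From HB Require Import structures.
From mathcomp Require Import all_boot all_order all_algebra all_fingroup.
From mathcomp Require Import all_classical all_reals all_analysis.

Set Implicit Arguments.
Unset Strict Implicit.
Unset Printing Implicit Defensive.

Import Order.TTheory GRing.Theory Num.Theory.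

Local Open Scope classical_set_scope.
Local Open Scope group_scope.

(* Subgroups of a possibly infinite group [gT] are predicates [set gT]. *)
Section Groups.
Context {gT : groupType}.
Implicit Types G H K N S : set gT.

Definition is_subgroup H := H 1 /\ forall x y, H x -> H y -> H (x * y^-1).

Definition normal_in G N :=
  [/\ is_subgroup N, N `<=` G & forall g x, G g -> N x -> N (x ^ g)].

Definition gen_by S : set gT := smallest is_subgroup S.

(* Used for [S `<=` G] only: otherwise no [normal_in G N] contains [S], and the
   intersection is the whole of [gT]. *)
Definition normal_closure G S : set gT := smallest (normal_in G) S.

Definition commutators H K : set gT :=
  [set c | exists x y, [/\ H x, K y & c = [~ x, y]]].

Definition right_cosets H K : set (set gT) :=
  [set [set k * h | k in K] | h in H].

Section Extended.
Variable R : realType.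
Local Open Scope ereal_scope.

Definition group_index H K : \bar R := counting (right_cosets H K).

(* [+oo] when [N] is not finitely normally generated. *)
Definition normal_gen_number G N : \bar R :=
  ereal_inf [set (size s)%:R%:E | s in
    [set s : seq gT | normal_closure G [set` s] = N]].

Definition normal_rank G : \bar R :=
  ereal_sup [set normal_gen_number G N | N in
    [set N | normal_in G N /\ normal_gen_number G N < +oo]].

End Extended.
End Groups.

Definition finite_index (gT : groupType) (G L : set gT) :=
  finite_set (right_cosets G L).

Section Tree.
Context {X : finType}.
Implicit Types u v w : seq X.

Definition adj u v :=
  (exists x, v = rcons u x) \/ (exists x, u = rcons v x).

Record autT := AutT {
  act :> seq X -> seq X;
  act_bij : bijective act;
  act_root : act [::] = [::];
  act_adj : forall u v, adj (act u) (act v) <-> adj u v }.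

Lemma autT_ext (f g : autT) : act f =1 act g -> f = g.
Proof.
case: f g => [f1 f2 f3 f4] [g1 g2 g3 g4] /= /funext fg.
move: f2 f3 f4; rewrite fg => f2 f3 f4.
by congr AutT; apply: Prop_irrelevance.
Qed.

HB.instance Definition _ := gen_eqMixin autT.
HB.instance Definition _ := gen_choiceMixin autT.

Lemma act_inj (f : autT) : injective f.
Proof. exact: bij_inj (act_bij f). Qed.

Lemma adjC u v : adj u v <-> adj v u.
Proof. by split=> -[]; [right|left|right|left]. Qed.

Lemma act_rcons (f : autT) u x : exists y, f (rcons u x) = rcons (f u) y.
Proof.
elim/last_ind: u x => [|u z IH] x.
  have /act_adj-/(_ f) : adj [::] [:: x] by left; exists x.
  rewrite act_root => -[[y ->]|[y]]; first by exists y.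
  by case: (f _).
have [t ft] := IH z.
have /act_adj-/(_ f) : adj (rcons u z) (rcons (rcons u z) x) by left; exists x.
case=> [[y ->]|[y]]; first by exists y.
rewrite ft => /rcons_inj[e _].
have /(congr1 size) := act_inj e.
by rewrite !size_rcons => /eqP; rewrite -[X in X == _]addn0 -addn2 eqn_add2l.
Qed.

Lemma size_act (f : autT) u : size (f u) = size u.
Proof.
elim/last_ind: u => [|u x IH]; first by rewrite act_root.
by have [y ->] := act_rcons f u x; rewrite !size_rcons IH.
Qed.

Definition section_fun (f : autT) u v := drop (size u) (f (u ++ v)).

Lemma section_funE (f : autT) u v : f (u ++ v) = f u ++ section_fun f u v.
Proof.
rewrite /section_fun; elim/last_ind: v => [|v x IH].
  by rewrite cats0 -(size_act f u) drop_size cats0.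
have [y e] := act_rcons f (u ++ v) x.
by rewrite -rcons_cat e IH !rcons_cat drop_size_cat // size_act.
Qed.

Lemma act_inv_subproof (f : autT) :
  exists g : autT, cancel f g /\ cancel g f.
Proof.
have [g fK gK] := act_bij f.
have gb : bijective g by exists f.
have g0 : g [::] = [::] by rewrite -[RHS]fK act_root.
have ga u v : adj (g u) (g v) <-> adj u v by rewrite -(act_adj f) !gK.
by exists (AutT gb g0 ga).
Qed.

Definition autT_inv (f : autT) : autT := sval (cid (act_inv_subproof f)).

Lemma autT_invP (f : autT) : cancel f (autT_inv f) /\ cancel (autT_inv f) f.
Proof. by rewrite /autT_inv; case: cid. Qed.

Lemma autT_one_adj u v : adj (idfun u) (idfun v) <-> adj u v.
Proof. by []. Qed.

Definition autT_one : autT :=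
  AutT (inv_bij (fun=> erefl)) (erefl : idfun [::] = [::]) autT_one_adj.

Lemma autT_mul_root (f g : autT) : (g \o f) [::] = [::].
Proof. by rewrite /= !act_root. Qed.

Lemma autT_mul_adj (f g : autT) u v : adj ((g \o f) u) ((g \o f) v) <-> adj u v.
Proof. by rewrite /= !act_adj. Qed.

(* Automorphisms act on the right: [f * g] is [f] followed by [g]. *)
Definition autT_mul (f g : autT) : autT :=
  AutT (bij_comp (act_bij g) (act_bij f)) (autT_mul_root f g) (autT_mul_adj f g).

Lemma autT_mulA : associative autT_mul.
Proof. by move=> f g h; apply: autT_ext. Qed.
Lemma autT_mul1g : left_id autT_one autT_mul.
Proof. by move=> f; apply: autT_ext. Qed.
Lemma autT_mulg1 : right_id autT_one autT_mul.
Proof. by move=> f; apply: autT_ext. Qed.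
Lemma autT_mulVg : left_inverse autT_one autT_inv autT_mul.
Proof. by move=> f; apply: autT_ext => u /=; rewrite (autT_invP f).2. Qed.
Lemma autT_mulgV : right_inverse autT_one autT_inv autT_mul.
Proof. by move=> f; apply: autT_ext => u /=; rewrite (autT_invP f).1. Qed.

HB.instance Definition _ := isGroup.Build autT
  autT_mulA autT_mul1g autT_mulg1 autT_mulVg autT_mulgV.

Lemma actM (f g : autT) u : (f * g) u = g (f u). Proof. by []. Qed.
Lemma act1 u : (1 : autT) u = u. Proof. by []. Qed.
Lemma actK (f : autT) u : f^-1 (f u) = u. Proof. exact: (autT_invP f).1. Qed.
Lemma actKV (f : autT) u : f (f^-1 u) = u. Proof. exact: (autT_invP f).2. Qed.

Lemma section_bij (f : autT) u : bijective (section_fun f u).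
Proof.
have h (g : autT) w z : section_fun g^-1 (g w) (section_fun g w z) = z.
  rewrite {1}/section_fun -section_funE actK.
  by rewrite size_act drop_size_cat.
exists (section_fun f^-1 (f u)) => z; first exact: h.
by have := h f^-1 (f u) z; rewrite actK (_ : f^-1^-1 = f) // invgK.
Qed.

Lemma section_root (f : autT) u : section_fun f u [::] = [::].
Proof. by rewrite /section_fun cats0 -(size_act f) drop_size. Qed.

Lemma adj_cat u v w : adj (u ++ v) (u ++ w) <-> adj v w.
Proof.
have h a b : (exists x, u ++ b = rcons (u ++ a) x) <-> (exists x, b = rcons a x).
  split=> -[x e]; exists x; last by rewrite e rcons_cat.
  have := congr1 (drop (size u)) e.
  by rewrite rcons_cat !drop_size_cat.
by rewrite /adj !h.
Qed.

Lemma section_adj (f : autT) u v w :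
  adj (section_fun f u v) (section_fun f u w) <-> adj v w.
Proof. by rewrite -(adj_cat (f u)) -!section_funE act_adj adj_cat. Qed.

Definition section u (f : autT) : autT :=
  AutT (section_bij f u) (section_root f u) (section_adj f u).

Lemma sectionE (f : autT) u v : f (u ++ v) = f u ++ section u f v.
Proof. exact: section_funE. Qed.

Definition stab u : set autT := [set f | f u = u].

Definition level_stab n : set autT := [set f | forall u, size u = n -> stab u f].

Definition psi (f : autT) : X -> autT := fun x => section [:: x] f.

Lemma level_stabS n : level_stab n.+1 `<=` level_stab n.
Proof.
move=> f fS [_|x u un]; first exact: act_root.
have [y e] := act_rcons f (x :: u) x.
have : rcons (f (x :: u)) y = rcons (x :: u) x.
  by rewrite -e; apply: fS; rewrite size_rcons un.
by case/rcons_inj.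
Qed.

Lemma level_stab_le m n : m <= n -> level_stab n `<=` level_stab m.
Proof.
move=> /subnK <-; elim: (n - m)%N => [//|k IH].
by rewrite addSn => f /level_stabS/IH.
Qed.

Definition autT_open (A : set autT) :=
  forall f, A f -> exists n, [set f * g | g in level_stab n] `<=` A.

Lemma autT_openT : autT_open setT.
Proof. by move=> f _; exists 0%N. Qed.

Lemma autT_openI A B : autT_open A -> autT_open B -> autT_open (A `&` B).
Proof.
move=> Ao Bo f [/Ao[m Am] /Bo[n Bn]]; exists (maxn m n) => _ [g gS <-]; split.
  by apply: Am; exists g => //; apply: level_stab_le gS; rewrite leq_maxl.
by apply: Bn; exists g => //; apply: level_stab_le gS; rewrite leq_maxr.
Qed.

Lemma autT_open_bigU (I : Type) (A : I -> set autT) :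
  (forall i, autT_open (A i)) -> autT_open (\bigcup_i A i).
Proof.
move=> Ao f [i _ /Ao[n nA]]; exists n => g /nA Ag.
by exists i.
Qed.

HB.instance Definition _ :=
  isOpenTopological.Build autT autT_openT autT_openI autT_open_bigU.

Definition level_transitive (G : set autT) :=
  forall u v, size u = size v -> exists2 g, G g & g u = v.

Definition self_similar (G : set autT) :=
  forall u, section u @` (G `&` stab u) `<=` G.

Definition regular_branch_over (G L : set autT) :=
  [/\ is_subgroup L, L `<=` G & finite_index G L] /\
  [/\ level_transitive G, self_similar G
    & [set s : X -> autT | forall x, L (s x)] `<=` psi @` (L `&` level_stab 1)].

Definition regular_branch G := exists L, regular_branch_over G L.

Definition open_normal (Gam Del : set autT) :=
  normal_in Gam Del /\ exists2 U, open U & Del = Gam `&` U.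

Definition elogb (R : realType) (p : nat) (x : \bar R) : \bar R :=
  (lne x * (ln p%:R)^-1%:E)%E.

(* Meant for [Gam] pro-[p], hence closed: the closure is then the one in [Gam]. *)
Definition central_width (R : realType) (p : nat) (Gam : set autT) : \bar R :=
  ereal_sup
    [set elogb p (group_index R Del (closure (gen_by (commutators Del Gam))))
       | Del in open_normal Gam].

(* The automorphism permuting the first letter by [s], with sections [t]. *)
Section Wreath.
Variables (s : {perm X}) (t : X -> autT).

Definition wreath_fun w := if w is x :: v then s x :: t x v else [::].

Lemma wreath_bij : bijective wreath_fun.
Proof.
exists (fun w => if w is y :: v then s^-1 y :: (t (s^-1 y))^-1 v else [::]).
  by case=> [//|x v] /=; rewrite permK actK.
by case=> [//|x v] /=; rewrite permKV actKV.
Qed.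

Lemma wreath_adj u v : adj (wreath_fun u) (wreath_fun v) <-> adj u v.
Proof.
have h a b : (exists x, b = rcons a x) ->
    exists x, wreath_fun b = rcons (wreath_fun a) x.
  move=> [z ->]; case: a => [|x a] /=; first by rewrite act_root; exists (s z).
  by have [y ->] := act_rcons (t x) a z; exists y.
have k a b : (exists x, wreath_fun b = rcons (wreath_fun a) x) ->
    exists x, b = rcons a x.
  case: a b => [|x a] [|y b] //= -[z] //=.
    by move=> [_ /(congr1 size)]; rewrite size_act; case: b => // _; exists y.
  move=> [/perm_inj <-]; case/lastP: b => [|b w].
    by rewrite act_root; case: (t y _).
  have [w' ->] := act_rcons (t y) b w.
  by move=> /rcons_inj[/act_inj -> _]; exists w.
by split=> -[] ?; [left|right|left|right]; auto.
Qed.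

Definition wreath : autT := AutT wreath_bij (erefl : wreath_fun [::] = [::]) wreath_adj.

End Wreath.

Lemma psi_wreath t : psi (wreath 1 t) = t.
Proof.
apply/funext => x; apply: autT_ext => v /=.
by rewrite /section_fun /= drop0.
Qed.

Lemma wreath1_stab t : level_stab 1 (wreath 1 t).
Proof. by move=> [|x []] //= _; rewrite /stab /= perm1 act_root. Qed.

Lemma autT_limit (g : nat -> autT) :
  (forall n u, size u <= n -> g n.+1 u = g n u)%N ->
  exists h : autT, forall n u, (size u <= n)%N -> h u = g n u.
Proof.
move=> gS; have gE n u : (size u <= n)%N -> g n u = g (size u) u.
  move=> /subnK <-; elim: (n - size u)%N => [//|k IH].
  by rewrite addSn gS ?IH // leq_addl.
pose h u := g (size u) u.
have hE n u : (size u <= n)%N -> h u = g n u by move=> /gE.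
have hb : bijective h.
  exists (fun u => (g (size u))^-1 u) => u; rewrite /h size_act ?actK //.
  by rewrite actKV.
have ha u v : adj (h u) (h v) <-> adj u v.
  by rewrite (hE (maxn (size u) (size v)) u) ?leq_maxl //
             (hE (maxn (size u) (size v)) v) ?leq_maxr // act_adj.
by exists (AutT hb (act_root _ : h [::] = [::]) ha).
Qed.

End Tree.

Arguments autT X : clear implicits.

Section Sunic.
Variable p : nat.

(* The letter [i] of {1, ..., p} is encoded by its residue class in 'F_p, so
   that the letter 1 is [1] and the last letter [p] is [0]. *)

Definition sunic_a : autT 'F_p := wreath (perm (@addrI 'F_p 1%R)) (fun=> 1).

(* [b 1, ..., b r] are the directed automorphisms; the other values of [b] are
   unconstrained.  An exponent in 'F_p stands for its representative in
   {0, ..., p - 1}. *)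
Definition directed_system (r : nat) (f : {poly 'F_p}) (b : nat -> autT 'F_p) :=
  [/\ forall i, (0 < i <= r)%N -> level_stab 1 (b i),
      forall i, (0 < i < r)%N ->
        psi (b i) = (fun x => if x == 0%R then b i.+1 else 1)
    & psi (b r) = (fun x =>
        if x == 1%R then sunic_a
        else if x == 0%R then \prod_(j < r) b j.+1 ^+ (- f`_j)%R
        else 1)].

Lemma directed_system_exists r f : exists b, directed_system r f b.
Proof.
pose F i (b : nat -> autT 'F_p) : 'F_p -> autT 'F_p := if i == r then
    fun x => if x == 1%R then sunic_a
      else if x == 0%R then \prod_(j < r) b j.+1 ^+ (- f`_j)%R else 1
  else fun x => if x == 0%R then b i.+1 else 1.
pose ag n (g h : autT 'F_p) := forall u, (size u <= n)%N -> g u = h u.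
have agM n g g' h h' : ag n g g' -> ag n h h' -> ag n (g * h) (g' * h').
  by move=> gg hh u un; rewrite !actM gg // hh // size_act.
have agF n i b b' : (forall j, ag n (b j) (b' j)) ->
    forall x, ag n (F i b x) (F i b' x).
  move=> bb x; rewrite /F; case: ifP => _; last by case: ifP => _ //.
  do 2!case: ifP => _ //.
  apply: (big_ind2 (ag n)); [by []|exact: agM|move=> j _].
  by elim: (nat_of_ord (- _)%R) => [//|k IH]; rewrite !expgS; apply: agM.
pose fix d (n i : nat) {struct n} : autT 'F_p := if n is m.+1 then wreath 1 (F i (d m)) else 1.
have dS n i : ag n (d n.+1 i) (d n i).
  elim: n i => [|n IH] i u; first by rewrite leqn0 size_eq0 => /eqP ->.
  by case: u => [//|x v] vn; rewrite /= (agF n i _ _ IH).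
have h i : exists g : autT 'F_p,
    forall n u, (size u <= n)%N -> g u = d n i u.
  exact: (autT_limit (g := d^~ i) (fun n => dS n i)).
have [b bE] := choice h.
have b1 i : level_stab 1 (b i).
  by move=> u u1; rewrite /stab /= (bE i 1%N) ?u1 //; apply: wreath1_stab.
have bF i : psi (b i) = F i b.
  apply/funext => x; apply: autT_ext => v.
  have := sectionE (b i) [:: x] v.
  rewrite (b1 i [:: x] erefl) (bE i (size v).+1) //= perm1 => -[<-].
  by apply: (agF (size v)) => [j u un|]; rewrite ?(bE j _ _ un).
exists b; split=> [i _|i /andP[_ ir]|]; rewrite ?bF /F ?eqxx //.
by rewrite ltn_eqF.
Qed.

Definition sunic_group (r : nat) (b : nat -> autT 'F_p) : set (autT 'F_p) :=
  gen_by ([set sunic_a] `|` [set b i | i in [set i | (0 < i <= r)%N]]).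

Definition sunic_K (r : nat) (b : nat -> autT 'F_p) : set (autT 'F_p) :=
  normal_closure (sunic_group r b)
    [set [~ sunic_a, b i] | i in [set i | (1 < i <= r)%N]].

Definition last_vertex n : seq 'F_p := nseq n 0%R.

End Sunic.

(* Main.v *)
(** Let [N] be a nontrivial normal subgroup of [G] and [n] maximal with [N] inside
    the stabiliser of level [n].  For [g] in [N] moving level [n + 1] and [k] in the
    branching subgroup [K], the commutator of [g] with the copy of [k] at a vertex
    [w] of level [n + 1] has sections [k] at [w] and a conjugate of [k^-1] at
    another vertex.  Conjugating by elements of [G] that act differently on the two
    vertices shows that [[N, G]] contains a copy of [[K, G]] at every vertex of
    level [n + 1], hence, as [[K, G]] contains the copies of [K] at level [1], a
    copy of [K] at every vertex of level [n + 2].  Here [K] is the normal closure of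
    the [[a, b_i]], with [i > 1] if [p = 2].

    The quotient of [N] by what it contains of these copies is filtered by
    [N /\ St(n + 1)], [N /\ St(n + 2)], and then by conditions on the sections at
    level [n + 2] along a central series of [G / K] with cyclic factors of order
    [p].  Each layer embeds into the permutation module [F_p[X^m]] of a level,
    which is uniserial for [G]: functions on [X^(m+1)] are graded by the degree in
    the last letter, and the total label [lab_sum m] of some generator of [G] is
    nonzero at every level [m].  A submodule of a uniserial module is cyclic, so
    every layer costs one normal generator and one factor [p] in [|N : [N, G]|].
    There are [2 + (r + 1)] layers for [p] odd, and [2 + (r + 2)] for [p = 2].

    The central width of the closure follows, because [D /\ G] is dense in an open
    normal subgroup [D] of it. *)

Require Import Defs.
From mathcomp Require Import all_boot all_order all_algebra all_fingroup.
From mathcomp Require Import all_classical all_reals all_analysis.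
From mathcomp Require Import zify ring.

Set Implicit Arguments.
Unset Strict Implicit.
Unset Printing Implicit Defensive.

Import Order.TTheory GRing.Theory Num.Theory.

Local Open Scope classical_set_scope.
Local Open Scope group_scope.

(** * Subgroups as predicates *)

Section Subgroups.
Variable gT : groupType.
Implicit Types (G H K N S : set gT) (x y g c : gT).

Lemma subgroup1 H : is_subgroup H -> H 1.
Proof. by case. Qed.

Lemma subgroupV H x : is_subgroup H -> H x -> H x^-1.
Proof. by move=> [H1 HM] Hx; rewrite -[x^-1]mul1g; apply: HM. Qed.

Lemma subgroupM H x y : is_subgroup H -> H x -> H y -> H (x * y).
Proof. by move=> sH Hx Hy; rewrite -[y]invgK; apply: sH.2 => //; apply: subgroupV. Qed.

Lemma subgroupX H x n : is_subgroup H -> H x -> H (x ^+ n).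
Proof.
move=> sH Hx; elim: n => [|n IH]; first exact: subgroup1.
by rewrite expgS; apply: subgroupM.
Qed.

Lemma subgroupJ H x y : is_subgroup H -> H x -> H y -> H (x ^ y).
Proof. by move=> sH Hx Hy; apply: subgroupM; [|exact: subgroupV|exact: subgroupM]. Qed.

Lemma subgroupR H x y : is_subgroup H -> H x -> H y -> H [~ x, y].
Proof. by move=> sH Hx Hy; apply: subgroupM; [|exact: subgroupV|exact: subgroupJ]. Qed.

Lemma subgroup_divr H x y : is_subgroup H -> H y -> H (x * y) -> H x.
Proof. by move=> sH Hy Hxy; rewrite -[x](mulgK y); apply: sH.2. Qed.

Lemma subgroup_divl H x y : is_subgroup H -> H x -> H (x * y) -> H y.
Proof.
by move=> sH Hx Hxy; rewrite -[y](mulKg x); apply: subgroupM => //; apply: subgroupV.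
Qed.

(** By Bezout [x] is a quotient of a power of [x ^+ m] by a power of [x ^+ n]. One of the two
    exponents will be the prime [p]. *)
Lemma subgroup_expg_inj H x m n : is_subgroup H -> coprime m n ->
  H (x ^+ m) -> H (x ^+ n) -> H x.
Proof.
move=> sH; case: m => [|m] mn Hm Hn; first by move: mn Hn; rewrite /coprime gcd0n => /eqP ->.
have [u v e _] := egcdnP n (isT : 0 < m.+1)%N.
have : H (x ^+ (u * m.+1)) by rewrite mulnC expgnA; apply: subgroupX.
rewrite e (eqP mn) expgnDr expg1; apply: subgroup_divl => //.
by rewrite mulnC expgnA; apply: subgroupX.
Qed.

Lemma subgroupI H K : is_subgroup H -> is_subgroup K -> is_subgroup (H `&` K).
Proof.
move=> sH sK; split; first by split; apply: subgroup1.
by move=> x y [? ?] [? ?]; split; [apply: sH.2|apply: sK.2].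
Qed.

Lemma gen_by_subgroup S : is_subgroup (gen_by S).
Proof.
split=> [H [[]] //|x y Sx Sy H [sH SH]].
by apply: sH.2; [apply: Sx|apply: Sy].
Qed.

Lemma gen_by_min S H : is_subgroup H -> S `<=` H -> gen_by S `<=` H.
Proof. exact: smallest_sub. Qed.

Lemma sub_gen_by S : S `<=` gen_by S.
Proof. exact: sub_gen_smallest. Qed.

Lemma normal_closure_normal G S :
  is_subgroup G -> S `<=` G -> normal_in G (normal_closure G S).
Proof.
move=> sG SG; have nG : normal_in G G by split=> // g x Gg Gx; apply: subgroupJ.
split; last first.
- move=> g x Gg Sx N [[sN NG nN] SN]; apply: (nN) => //.
  exact: (Sx N (conj (And3 sN NG nN) SN)).
- exact: smallest_sub.
- split=> [N [[[]]] //|x y Sx Sy N [nN SN]].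
  have [sN _ _] := nN.
  by apply: sN.2; [apply: Sx|apply: Sy].
Qed.

Lemma normal_closure_min G S N : normal_in G N -> S `<=` N -> normal_closure G S `<=` N.
Proof. exact: smallest_sub. Qed.

Lemma sub_normal_closure G S : S `<=` normal_closure G S.
Proof. exact: sub_gen_smallest. Qed.

Lemma normal_closure_mono G S S' : S `<=` S' -> normal_closure G S `<=` normal_closure G S'.
Proof. by move=> SS' x Sx N [nN S'N]; apply: Sx; split=> // y /SS'/S'N. Qed.

Lemma normal_closure0 G : is_subgroup G -> normal_closure G set0 = [set 1].
Proof.
move=> sG; rewrite eqEsubset; split; last first.
  by move=> _ -> N [[[]]].
apply: normal_closure_min => //; split.
- by split=> // _ _ -> ->; rewrite mulgV.
- by move=> _ ->; apply: subgroup1.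
- by move=> g _ _ ->; rewrite conj1g.
Qed.

(** * Commutator subgroups and centralisers modulo a normal subgroup *)

Definition commg_group N G := gen_by (commutators N G).

Lemma commg_groupP N G x g : N x -> G g -> commg_group N G [~ x, g].
Proof. by move=> Nx Gg; apply: sub_gen_by; exists x, g. Qed.

Lemma normal_commgl N G x g : normal_in G N -> N x -> G g -> N [~ x, g].
Proof.
move=> [sN _ nN] Nx Gg; rewrite commgEl.
by apply: subgroupM => //; [apply: subgroupV|apply: nN].
Qed.

Lemma normal_commgr N G x g : normal_in G N -> N x -> G g -> N [~ g, x].
Proof.
by move=> nN Nx Gg; rewrite -invgR; apply: subgroupV; [case: nN|apply: normal_commgl nN _ _].
Qed.

Lemma commg_group_sub N G : normal_in G N -> commg_group N G `<=` N.
Proof.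
move=> nN; apply: gen_by_min; first by case: nN.
by move=> _ [x [g [Nx Gg ->]]]; apply: normal_commgl Gg.
Qed.

Lemma commg_group_mono N N' G G' : N `<=` N' -> G `<=` G' ->
  commg_group N G `<=` commg_group N' G'.
Proof.
move=> NN' GG'; apply: gen_by_min; first exact: gen_by_subgroup.
by move=> _ [x [g [Nx Gg ->]]]; apply: commg_groupP; [apply: NN'|apply: GG'].
Qed.

Lemma commg_group_normal N G : is_subgroup G -> normal_in G N ->
  normal_in G (commg_group N G).
Proof.
move=> sG nN; have [sN NG nNG] := nN; split.
- exact: gen_by_subgroup.
- by move=> x /(commg_group_sub nN) /NG.
- move=> g x Gg Cx; pose P := [set y | commg_group N G (y ^ g)].
  suff : commg_group N G `<=` P by apply.
  apply: gen_by_min.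
    split=> [|y z]; rewrite /P /= ?conj1g ?conjMg ?conjVg.
      by apply: subgroup1; apply: gen_by_subgroup.
    by move=> Py Pz; apply: (gen_by_subgroup _).2.
  move=> _ [y [h [Ny Gh ->]]]; rewrite /P /= conjRg.
  by apply: commg_groupP; [apply: (nNG)|apply: subgroupJ].
Qed.

(* The stabiliser of the coset [x N] for the conjugation action of [G]. *)
Lemma commg_stab_subgroup G N x : is_subgroup G -> normal_in G N ->
  is_subgroup [set g | G g /\ N [~ x, g]].
Proof.
move=> sG [sN NG nN].
have CM g h : [~ x, g * h] = [~ x, h] * [~ x, g] ^ h.
  by rewrite /commg /conjg !gnorm.
split=> [|g h [Gg Ng] [Gh Nh]]; first by split; [exact: subgroup1|rewrite commg1; exact: subgroup1].
split; first exact: sG.2.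
rewrite CM; apply: subgroupM => //; last by apply: (nN) => //; apply: subgroupV.
have -> : [~ x, h^-1] = ([~ x, h]^-1) ^ h^-1.
  by apply: (mulIg ([~ x, h] ^ h^-1)); rewrite -CM mulgV commg1 -conjMg mulVg conj1g.
by apply: (nN); apply: subgroupV.
Qed.

(** This is the centraliser of [K] modulo [N]. Conjugating [t] by [g] amounts to conjugating [k] by
    [g^-1] and the commutator by [g], which [K] and [N] absorb. *)
Lemma commg_stab_normal G N K : is_subgroup G -> normal_in G N -> normal_in G K ->
  normal_in G [set g | G g /\ forall k, K k -> N [~ k, g]].
Proof.
move=> sG nN nK; split.
- split=> [|g h [Gg Ng] [Gh Nh]].
    split; first exact: subgroup1.
    by move=> k _; rewrite commg1; apply: subgroup1; case: nN.
  split=> [|k Kk]; first exact: sG.2.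
  have := commg_stab_subgroup k sG nN.
  by case=> _ /(_ g h)[]; [split=> //; apply: Ng|split=> //; apply: Nh|].
- by move=> g [].
- move=> g t Gg [Gt Nt]; split; first exact: subgroupJ.
  move=> k Kk; have [_ _ nNG] := nN; have [_ _ nKG] := nK.
  rewrite -(conjgKV g k) -conjRg; apply: (nNG) => //.
  by apply: Nt; apply: (nKG) => //; apply: subgroupV.
Qed.

(** Being a normal subgroup, the set of elements of [K] that are central modulo [N] can be tested on
    normal generators of [K]. *)
Lemma commg_central_normal G N K : is_subgroup G -> normal_in G N -> normal_in G K ->
  normal_in G [set k | K k /\ forall g, G g -> N [~ k, g]].
Proof.
move=> sG nN nK; have [sN NG nNG] := nN; have [sK KG nKG] := nK; split.
- split=> [|x y [Kx Nx] [Ky Ny]].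
    by split=> [|g _]; rewrite ?comm1g; apply: subgroup1.
  split=> [|g Gg]; first exact: sK.2.
  have Gy : G y^-1 by apply: subgroupV => //; apply: KG.
  have -> : [~ x * y^-1, g] = [~ x, g] ^ y^-1 * ([~ y, g]^-1) ^ y^-1.
    by rewrite /commg /conjg !gnorm.
  by apply: subgroupM => //; apply: (nNG) => //; [apply: Nx|apply: subgroupV => //; apply: Ny].
- by move=> k [/KG].
- move=> g k Gg [Kk Nk]; split=> [|h Gh]; first exact: nKG.
  rewrite -(conjgKV g h) -conjRg; apply: (nNG) => //; apply: Nk.
  by apply: subgroupJ => //; apply: subgroupV.
Qed.

(** For [H] normal, [c] central modulo [H] and a positive power of [c] in [H], this is the subgroup
    generated by [H] and [c]; natural exponents then reach all cosets. *)
Definition cyclic_ext H c : set gT := [set x | exists i : nat, H (c ^- i * x)].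

Lemma sub_cyclic_ext H c : H `<=` cyclic_ext H c.
Proof. by move=> x Hx; exists 0%N; rewrite expg0 invg1 mul1g. Qed.

Lemma cyclic_ext_id H c : is_subgroup H -> cyclic_ext H c c.
Proof. by move=> sH; exists 1%N; rewrite expg1 mulVg; apply: subgroup1. Qed.

Lemma commg_cyclic_ext G H c x g : is_subgroup G -> normal_in G H -> G c ->
  (forall h, G h -> H [~ c, h]) -> cyclic_ext H c x -> G g -> H [~ x, g].
Proof.
move=> sG nH Gc Hc [i Hx] Gg.
have nC := commg_central_normal sG nH (And3 sG (fun _ p => p) (fun g x Gg Gx => subgroupJ sG Gx Gg)).
have [sC _ _] := nC.
suff: [set k | G k /\ (forall g : gT, G g -> H [~ k, g])] x by case=> _; apply.
rewrite -[x](mulVKg (c ^+ i)); apply: subgroupM => //.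
  by apply: subgroupX => //; split.
by split=> [|h Gh]; [have [_ HG _] := nH; apply: HG|exact: normal_commgl nH _ Gh].
Qed.

Lemma cyclic_ext_normal G H c p : is_subgroup G -> normal_in G H -> G c -> (0 < p)%N ->
  (forall h, G h -> H [~ c, h]) -> H (c ^+ p) -> normal_in G (cyclic_ext H c).
Proof.
move=> sG nH Gc p0 Hc Hp; have [sH HG nHG] := nH.
have ext_sub x y i j : H (c ^- i * x) -> H (c ^- j * y) -> cyclic_ext H c (x * y^-1).
  (* As [c ^+ p] lies in [H], the exponent [p.-1 * j] plays the role of [- j]. *)
  move=> Hx Hy; exists (i + (p.-1 * j))%N.
  have e : H (c ^+ j * c ^+ (p.-1 * j)).
    by rewrite -expgnDr -mulSn prednK // expgnA; apply: subgroupX.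
  have Gi : G (c ^+ (p.-1 * j)) by apply: subgroupX.
  rewrite expgnDr invgM.
  have -> : c ^- (p.-1 * j) * c ^- i * (x * y^-1) =
    (c ^- i * x) ^ (c ^+ (p.-1 * j)) * ((c ^+ j * c ^+ (p.-1 * j))^-1
      * ((c ^- j * y)^-1 ^ (c ^- j)))
    by rewrite /conjg !gnorm.
  apply: subgroupM => //; first by apply: (nHG).
  apply: subgroupM => //; first exact: subgroupV.
  by apply: (nHG); [apply: subgroupV => //; exact: subgroupX|exact: subgroupV].
split.
- split; first by apply: sub_cyclic_ext; apply: subgroup1.
  by move=> x y [i Hx] [j Hy]; apply: (ext_sub) Hx Hy.
- move=> x [i Hx]; rewrite -[x](mulVKg (c ^+ i)).
  by apply: subgroupM => //; [apply: subgroupX|apply: HG].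
- move=> g x Gg [i Hx]; exists i.
  have -> : c ^- i * x ^ g = (c ^- i * x) * [~ x, g].
    by rewrite /commg /conjg !gnorm.
  apply: subgroupM => //; apply: (commg_cyclic_ext sG nH Gc Hc _ Gg).
  by exists i.
Qed.

End Subgroups.

(** * Sections and automorphisms supported below a vertex *)

Section TreeAutomorphisms.
Variable X : finType.
Implicit Types (g h x : autT X) (u v w : seq X).

Lemma section_eq g u v w : g (u ++ v) = g u ++ w -> section u g v = w.
Proof. by rewrite sectionE => /eqP; rewrite eqseq_cat // eqxx => /eqP. Qed.

Lemma section_cat u v g : section (u ++ v) g = section v (section u g).
Proof.
apply: autT_ext => w; apply: section_eq.
by rewrite -catA [LHS]sectionE sectionE sectionE catA.
Qed.

Lemma section_nil g : section [::] g = g.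
Proof. by apply: autT_ext => w; apply: section_eq; rewrite act_root. Qed.

Lemma section1 u : section u (1 : autT X) = 1.
Proof. by apply: autT_ext => w; apply: section_eq. Qed.

Lemma sectionM u g h : section u (g * h) = section u g * section (g u) h.
Proof. by apply: autT_ext => w; apply: section_eq; rewrite !Defs.actM !sectionE. Qed.

Lemma sectionV u g : section (g u) g^-1 = (section u g)^-1.
Proof. by apply: (mulgI (section u g)); rewrite -sectionM !mulgV section1. Qed.

Lemma sectionJ u g h : g u = u -> section (h u) (g ^ h) = section u g ^ section u h.
Proof.
move=> gu; rewrite /conjg !sectionM sectionV; congr (_ * (_ * _)).
  by rewrite Defs.actK.
by rewrite Defs.actK gu.
Qed.

Lemma stab_subgroup u : is_subgroup (stab u).
Proof. by split=> // g h gu hu; rewrite /stab /= gu -[X in h^-1 X]hu Defs.actK. Qed.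

Lemma stabV u g : g u = u -> g^-1 u = u.
Proof. exact: (subgroupV (stab_subgroup u)). Qed.

Lemma sectionV_fix u g : g u = u -> section u g^-1 = (section u g)^-1.
Proof. by move=> gu; rewrite -sectionV gu. Qed.

Lemma sectionR u g h : g u = u -> h u = u ->
  section u [~ g, h] = [~ section u g, section u h].
Proof.
move=> gu hu; rewrite !commgEl sectionM sectionV_fix // stabV //.
by rewrite -[X in section X (_ ^ _)]hu sectionJ.
Qed.

Lemma level_stab_subgroup n : is_subgroup (@level_stab X n).
Proof.
split=> [u _ //|g h gS hS u un]; apply: (stab_subgroup u).2; first exact: gS.
exact: hS.
Qed.

Lemma level_stabJ n g h : level_stab n g -> level_stab n (g ^ h).
Proof.
move=> gS u un; rewrite /stab /= (gS (h^-1 u)) ?size_act //.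
exact: Defs.actKV.
Qed.

Lemma level_stab_normal (G N : set (autT X)) n : normal_in G N ->
  normal_in G (N `&` level_stab n).
Proof.
move=> [sN NG nN]; split=> [|g [/NG]//|g h Gg [Nh Sh]].
  exact: subgroupI (level_stab_subgroup n).
by split; [exact: nN|exact: level_stabJ].
Qed.

Lemma level_stab_act n g u : level_stab n g -> (size u <= n)%N -> g u = u.
Proof. by move=> gS un; apply: (level_stab_le un gS). Qed.

Lemma level_stab_section m n g u : level_stab (m + n) g -> size u = m ->
  level_stab n (section u g).
Proof.
move=> gS um v vn; apply: section_eq; rewrite (gS (u ++ v)) ?size_cat ?um ?vn //.
by rewrite (level_stab_act gS) // um leq_addr.
Qed.

Lemma level_stab_cat m n g : level_stab m g ->
  (forall u, size u = m -> level_stab n (section u g)) -> level_stab (m + n) g.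
Proof.
move=> gS gn u un; rewrite /stab /= -(cat_take_drop m u) sectionE.
have tm : size (take m u) = m by rewrite size_takel // un leq_addr.
by rewrite gS // gn // size_drop un addKn.
Qed.

(** The copy of [g] at the vertex [u]; for fixed [u] these copies form the rigid stabiliser of
    [u]. *)
Fixpoint at_word u g : autT X :=
  if u is x :: v then wreath 1 (fun z => if z == x then at_word v g else 1) else g.

Lemma at_wordE u g v : at_word u g (u ++ v) = u ++ g v.
Proof. by elim: u => [//|x u IH] /=; rewrite perm1 eqxx IH. Qed.

Lemma at_word_out u g w : ~~ prefix u w -> at_word u g w = w.
Proof.
elim: u w => [|x u IH] [|y w] //=; rewrite perm1 eq_sym.
by case: eqP => [-> /= /IH ->|].
Qed.

Lemma at_word_fix u g w : (size w <= size u)%N -> at_word u g w = w.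
Proof.
move=> wu; case: (boolP (prefix u w)) => [/prefixP[v e]|/at_word_out //].
have : v = [::].
  by case: v e wu => // z v ->; rewrite size_cat /= addnS ltnNge leq_addr.
by rewrite e => ->; rewrite at_wordE act_root.
Qed.

Lemma at_word_stab u g : level_stab (size u) (at_word u g).
Proof. by move=> w e; rewrite /stab /= at_word_fix // e. Qed.

Lemma at_word_cat u v g : at_word (u ++ v) g = at_word u (at_word v g).
Proof. by elim: u => [//|x u IH] /=; rewrite IH. Qed.

Lemma at_wordM u g h : at_word u (g * h) = at_word u g * at_word u h.
Proof.
apply: autT_ext => w; rewrite Defs.actM.
case: (boolP (prefix u w)) => [/prefixP[v ->]|uw]; first by rewrite !at_wordE.
by rewrite !at_word_out.
Qed.

Lemma at_word1 u : at_word u 1 = 1.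
Proof. by apply: (mulgI (at_word u 1)); rewrite -at_wordM !mulg1. Qed.

Lemma at_wordV u g : at_word u g^-1 = (at_word u g)^-1.
Proof. by apply: (mulgI (at_word u g)); rewrite -at_wordM !mulgV at_word1. Qed.

Lemma prefix_act g u w : prefix (g u) (g w) = prefix u w.
Proof.
apply/idP/idP => /prefixP[v e]; apply/prefixP; last first.
  by exists (section u g v); rewrite e sectionE.
exists (section (g u) g^-1 v); rewrite -[w](Defs.actK g) e sectionE Defs.actK //.
Qed.

Lemma at_wordJ u g h : at_word u g ^ h = at_word (h u) (g ^ section u h).
Proof.
apply: (mulgI h); rewrite -conjgC; apply: autT_ext => w; rewrite !Defs.actM.
case: (boolP (prefix u w)) => [/prefixP[v ->]|uw].
  by rewrite at_wordE !(sectionE h) at_wordE -(Defs.actM (section u h)) -conjgC.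
by rewrite (at_word_out _ uw) at_word_out // prefix_act.
Qed.

Lemma section_at_word u g w : size w = size u ->
  section w (at_word u g) = if w == u then g else 1.
Proof.
move=> wu; apply: autT_ext => v; apply: section_eq.
rewrite (@at_word_fix u g w) ?wu //; case: eqP => [->|ne]; first by rewrite at_wordE.
rewrite at_word_out //; apply/negP => /prefixP[v' /eqP].
by rewrite eqseq_cat // => /andP[/eqP].
Qed.

(** On a word starting with [y] only the factor at [y] acts, whatever the order of the factors. *)
Lemma level_stab1_prod g : level_stab 1 g -> g = \prod_(z : X) at_word [:: z] (section [:: z] g).
Proof.
move=> gS.
have prodE (s : seq X) y v : uniq s ->
    (\prod_(z <- s) at_word [:: z] (section [:: z] g)) (y :: v)
    = y :: if y \in s then section [:: y] g v else v.
  elim: s v => [|z s IH] v /=; first by rewrite big_nil.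
  case/andP=> zs us; rewrite big_cons Defs.actM /= perm1 IH // in_cons.
  case: (eqVneq y z) => [->|_] //=.
  by rewrite (negbTE zs).
apply: autT_ext => -[|y v]; first by rewrite !act_root.
rewrite prodE ?index_enum_uniq // mem_index_enum.
by rewrite -[y :: v]/([:: y] ++ v) sectionE (gS [:: y]).
Qed.

(** By induction on the level: split [g] into copies at the letters and apply the hypothesis, for
    each letter [z], to the subgroup of those [h] whose copy at [z] lies in [D]. *)
Lemma at_word_generate (D K : set (autT X)) n g : is_subgroup D ->
    (forall w k, size w = n -> K k -> D (at_word w k)) ->
  level_stab n g -> (forall w, size w = n -> K (section w g)) -> D g.
Proof.
elim: n D g => [|n IH] D g sD DK gS gK.
  by apply: (DK [::]) => //; rewrite -[g]section_nil; apply: gK.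
rewrite [g]level_stab1_prod; last exact: level_stab_le gS.
have [D1 _] := sD.
apply: (big_ind D) => // [x y|z _]; first exact: subgroupM.
apply: (IH [set h | D (at_word [:: z] h)]).
- split=> [|x y Dx Dy]; rewrite /mkset ?at_word1 // at_wordM at_wordV.
  exact: sD.2.
- by move=> w k wn Kk; apply: (DK (z :: w)); rewrite //= wn.
- exact: (@level_stab_section 1).
- by move=> w wn; rewrite -section_cat; apply: gK; rewrite /= wn.
Qed.

End TreeAutomorphisms.

(** * Labels and functions on a level *)

Section Labels.
Variable p : nat.
Hypothesis pp : prime p.
Implicit Types (g h : autT 'F_p) (u v w : seq 'F_p) (phi : seq 'F_p -> 'F_p).

(* For [g] in [shifting], the exponent of [a] in the label of [g] at [v]. *)
Definition lab g v : 'F_p := last 0%R (g (rcons v 0%R)).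

(** The infinitely iterated wreath product of cyclic groups of order [p]: all local permutations are
    translations. *)
Definition shifting : set (autT 'F_p) :=
  [set g : autT _ | forall v x, g (rcons v x) = rcons (g v) (x + lab g v)%R].

Lemma labM g h v : shifting g -> shifting h ->
  lab (g * h) v = (lab g v + lab h (g v))%R.
Proof. by move=> gS hS; rewrite {1}/lab Defs.actM gS hS last_rcons add0r. Qed.

Lemma lab_section u g v : lab (section u g) v = lab g (u ++ v).
Proof.
rewrite /lab rcons_cat sectionE.
by have [y ->] := act_rcons (section u g) v 0%R; rewrite -rcons_cat !last_rcons.
Qed.

Lemma lab1 v : lab 1 v = 0%R.
Proof. by rewrite /lab Defs.act1 last_rcons. Qed.

(** Truncation in depth allows induction on the level, as the directed automorphisms are only given
    recursively. *)
Definition shifting_upto n : set (autT 'F_p) := [set g : autT _ | forall v x,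
  (size v <= n)%N -> g (rcons v x) = rcons (g v) (x + lab g v)%R].

Lemma shifting_upto_subgroup n : is_subgroup (shifting_upto n).
Proof.
split=> [v x _|g h gS hS v x vn]; first by rewrite lab1 addr0.
have hVS w y : (size w <= n)%N ->
    h^-1 (rcons w y) = rcons (h^-1 w) (y - lab h ((h^-1)%g w))%R.
  by move=> wn; apply: (@Defs.act_inj _ h); rewrite hS ?size_act // !Defs.actKV subrK.
by rewrite /lab !Defs.actM !gS // !hVS ?size_act // last_rcons add0r addrA.
Qed.

Lemma shifting_subgroup : is_subgroup shifting.
Proof.
split=> [v x|g h gS hS v x]; first by rewrite lab1 addr0.
by apply: (shifting_upto_subgroup (size v)).2.
Qed.

Lemma level_stab_lab n g : shifting g -> level_stab n g ->
  (forall w, size w = n -> lab g w = 0%R) -> level_stab n.+1 g.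
Proof.
move=> gS gn g0 w; case/lastP: w => [//|w x]; rewrite size_rcons => -[wn].
by rewrite /stab /= gS g0 // addr0 gn.
Qed.

(** * Sums over a level and total labels *)

Fixpoint level_sum n phi : 'F_p :=
  if n is m.+1 then level_sum m (fun u => \sum_x phi (rcons u x))%R else phi [::].

Lemma eq_level_sum n phi psi : (forall u, size u = n -> phi u = psi u) ->
  level_sum n phi = level_sum n psi.
Proof.
elim: n phi psi => [|n IH] phi psi e /=; first exact: e.
by apply: IH => u un; apply: eq_bigr => x _; apply: e; rewrite size_rcons un.
Qed.

Lemma level_sumD n phi psi :
  level_sum n (fun u => phi u + psi u)%R = (level_sum n phi + level_sum n psi)%R.
Proof.
elim: n phi psi => [//|n IH] phi psi /=; rewrite -IH.
by apply: eq_level_sum => u _; rewrite big_split.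
Qed.

Lemma level_sum_act n phi h : shifting h ->
  level_sum n (fun u => phi (h u)) = level_sum n phi.
Proof.
move=> hS; elim: n phi => [|n IH] phi /=; first by rewrite act_root.
rewrite -[RHS]IH; apply: eq_level_sum => u _.
rewrite [RHS](reindex_inj (addIr (lab h u))).
by apply: eq_bigr => x _; rewrite hS.
Qed.

Lemma level_sum_cons n phi :
  level_sum n.+1 phi = (\sum_x level_sum n (fun u => phi (x :: u)))%R.
Proof.
elim: n phi => [//|n IH] phi; rewrite -[LHS]/(level_sum n.+1 _) IH.
by apply: eq_bigr.
Qed.

Definition lab_sum k g := level_sum k (lab g).

(** Labels obey the cocycle law [labM], and [g] permutes the level, so summation turns the cocycle
    into a homomorphism. *)
Lemma lab_sumM k g h : shifting g -> shifting h ->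
  lab_sum k (g * h) = (lab_sum k g + lab_sum k h)%R.
Proof.
move=> gS hS; rewrite /lab_sum -(level_sum_act k (lab h) gS) -level_sumD.
by apply: eq_level_sum => u _; rewrite labM.
Qed.

Lemma lab_sum_section k g :
  lab_sum k.+1 g = (\sum_x lab_sum k (section [:: x] g))%R.
Proof.
rewrite /lab_sum level_sum_cons; apply: eq_bigr => x _.
by apply: eq_level_sum => u _; rewrite lab_section.
Qed.

Lemma lab_sum1 k : lab_sum k 1 = 0%R.
Proof.
have := lab_sumM k (subgroup1 shifting_subgroup) (subgroup1 shifting_subgroup).
by rewrite mulg1 => /eqP; rewrite -subr_eq0 opprD addNKr oppr_eq0 => /eqP.
Qed.

Lemma lab_sum_ker k : is_subgroup [set g : autT _ | shifting g /\ lab_sum k g = 0%R].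
Proof.
have sS := shifting_subgroup.
split; first by split; [exact: subgroup1|exact: lab_sum1].
move=> g h [gS g0] [hS h0]; split; first exact: sS.2.
have hVS := subgroupV sS hS.
by rewrite lab_sumM // g0 add0r -[LHS]add0r -h0 -lab_sumM // mulgV lab_sum1 h0.
Qed.

(* Functions on level [m] are represented by functions on all words that vanish
   off level [m]. *)
Definition level_fun m : set (seq 'F_p -> 'F_p) :=
  [set phi | forall w, size w != m -> phi w = 0%R].

Definition level_cst m w : 'F_p := (size w == m)%:R%R.

(** Scalars in 'F_p act as natural multiples, so additive subgroups are subspaces. *)
Definition submodule (G : set (autT 'F_p)) m (M : set (seq 'F_p -> 'F_p)) :=
  [/\ M `<=` level_fun m, M (fun=> 0%R),
      forall phi psi, M phi -> M psi -> M (fun w => phi w - psi w)%R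
    & forall h phi, G h -> M phi -> M (fun w => phi (h w))].

Definition cyclic_module G m (M : set (seq 'F_p -> 'F_p)) :=
  exists2 phi, M phi & forall M', submodule G m M' -> M' phi -> M `<=` M'.

Lemma submoduleD G m M phi psi : submodule G m M -> M phi -> M psi ->
  M (fun w => phi w + psi w)%R.
Proof.
move=> [_ M0 MB _] Mf Mg.
have := MB _ _ Mf (MB _ _ M0 Mg); congr M; apply: funext => w.
by rewrite sub0r opprK.
Qed.

Lemma submodule_subK G m M phi psi : submodule G m M -> M psi ->
  M (fun w => phi w - psi w)%R -> M phi.
Proof.
move=> sM Mg Md; have := submoduleD sM Md Mg; congr M.
by apply: funext => w; rewrite subrK.
Qed.

Lemma submoduleMn G m M phi k : submodule G m M -> M phi ->
  M (fun w => phi w *+ k)%R.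
Proof.
move=> sM Mf; elim: k => [|k IH]; first by have [] := sM.
have := submoduleD sM Mf IH; congr M; apply: funext => w.
by rewrite mulrS.
Qed.

Lemma submodule_zero G m : submodule G m [set (fun=> 0%R)].
Proof.
split=> //; first by move=> _ ->.
- by move=> _ _ -> ->; apply: funext => w; rewrite subr0.
- by move=> h _ _ ->.
Qed.

(** * Finite differences in the last letter *)

Definition shift_last w : seq 'F_p :=
  if w is x :: v then rcons (belast x v) (last x v + 1)%R else [::].

Lemma shift_last_rcons v x : shift_last (rcons v x) = rcons v (x + 1)%R.
Proof.
by case: v => [//|y v]; rewrite /= last_rcons belast_rcons.
Qed.

Lemma size_shift_last w : size (shift_last w) = size w.
Proof. by case/lastP: w => [//|v x]; rewrite shift_last_rcons !size_rcons. Qed.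

Lemma act_shift_last h w : shifting h -> h (shift_last w) = shift_last (h w).
Proof.
move=> hS; case/lastP: w => [|v x]; first by rewrite /= act_root.
by rewrite shift_last_rcons !hS shift_last_rcons addrAC.
Qed.

Lemma iter_shift_last i v x : iter i shift_last (rcons v x) = rcons v (x + i%:R)%R.
Proof.
elim: i => [|i IH]; first by rewrite addr0.
by rewrite iterS IH shift_last_rcons -addrA natr1.
Qed.

(** The forward difference in the last letter, a substitute for the derivative: the functions killed
    by its [e]-th iterate are those of degree less than [e] in that letter. *)
Definition Delta phi w := (phi (shift_last w) - phi w)%R.

Notation DeltaX e := (iter e Delta).

Lemma Delta_fun m phi : level_fun m phi -> level_fun m (Delta phi).
Proof. by move=> f0 w wm; rewrite /Delta !f0 ?subr0 // size_shift_last. Qed.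

Lemma DeltaX_fun m e phi : level_fun m phi -> level_fun m (DeltaX e phi).
Proof. by move=> f0; elim: e => [//|e IH]; apply: Delta_fun. Qed.

Lemma Delta_act h phi : shifting h -> Delta (fun w => phi (h w)) = fun w => Delta phi (h w).
Proof. by move=> hS; apply: funext => w; rewrite /Delta act_shift_last. Qed.

Lemma DeltaX_act e h phi : shifting h ->
  DeltaX e (fun w => phi (h w)) = fun w => DeltaX e phi (h w).
Proof. by move=> hS; elim: e => [//|e IH]; rewrite !iterS IH Delta_act. Qed.

Lemma DeltaXB e phi psi : DeltaX e (fun w => phi w - psi w)%R =
  fun w => (DeltaX e phi w - DeltaX e psi w)%R.
Proof.
elim: e => [//|e IH]; rewrite !iterS IH; apply: funext => w.
by rewrite /Delta; ring.
Qed.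

Lemma DeltaX0 e : DeltaX e (fun=> 0%R) = fun=> 0%R.
Proof.
by elim: e => [//|e IH]; rewrite iterS IH; apply: funext => w; rewrite /Delta subr0.
Qed.

(** The shift is [1 + Delta]; this is the binomial expansion of its [e]-th power, by Pascal's
    rule. *)
Lemma Newton_shift phi e w :
  phi (iter e shift_last w) = (\sum_(i < e.+1) DeltaX i phi w *+ 'C(e, i))%R.
Proof.
elim: e w => [|e IH] w; first by rewrite big_ord1.
rewrite iterSr IH.
transitivity (\sum_(i < e.+1) (DeltaX i phi w *+ 'C(e, i) + DeltaX i.+1 phi w *+ 'C(e, i)))%R.
  by apply: eq_bigr => i _; rewrite -mulrnDl iterS /Delta addrC subrK.
rewrite big_split /= [in RHS]big_ord_recl bin0.
under [in RHS]eq_bigr => i _ do rewrite lift0 binS mulrnDr.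
rewrite big_split /= addrA; congr (_ + _)%R.
by rewrite [in RHS]big_ord_recr /= bin_small // mulr0n addr0 big_ord_recl bin0.
Qed.

Lemma iter_shift_last_p w : iter p shift_last w = w.
Proof.
have e i : iter i shift_last [::] = [::] by elim: i => // i IH; rewrite iterS IH.
by case/lastP: w => [|v x]; rewrite ?e // iter_shift_last pchar_Fp_0 // addr0.
Qed.

(** In Newton's formula for [p] shifts, which amount to the identity, the middle binomial
    coefficients vanish modulo [p]. *)
Lemma DeltaXp phi : DeltaX p phi = fun=> 0%R.
Proof.
(* Since [p] also occurs in the type of letters, only the exponent is replaced by [q.+1]. *)
have [q qp] : exists q, q.+1 = p by exists p.-1; rewrite prednK // prime_gt0.
rewrite -[X in iter X]qp; apply: funext => w; have := Newton_shift phi q.+1 w.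
have -> : iter q.+1 shift_last w = w by rewrite qp iter_shift_last_p.
rewrite big_ord_recr binn mulr1n big_ord_recl /= bin0 mulr1n big1 => [|i _].
  by rewrite addr0 -[X in X = _]addr0 => /addrI.
have pC : p %| 'C(q.+1, lift ord0 i).
  by rewrite lift0 qp; apply: prime_dvd_bin => //; rewrite /= -qp ltnS ltn_ord.
by rewrite -(divnK pC) mulnC mulrnA -(mulr_natr _ p) pchar_Fp_0 // mulr0 mul0rn.
Qed.

Lemma sum_Fp (F : 'F_p -> 'F_p) : (\sum_x F x = \sum_(i < p) F i%:R)%R.
Proof.
suff h n : (Zp_trunc (pdiv p)).+2 = n -> (\sum_x F x = \sum_(i < n) F i%:R)%R.
  exact/h/Fp_cast.
by move=> <-; apply: eq_bigr => i _; rewrite natr_Zp.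
Qed.

Lemma sum_bin n k : (\sum_(i < n) 'C(i, k) = 'C(n, k.+1))%N.
Proof.
elim: n => [|n IH]; first by rewrite big_ord0 bin0n.
by rewrite big_ord_recr IH binS.
Qed.

(** After Newton's formula and summation over the shifts, the coefficient of [DeltaX j] is
    ['C(p, j.+1)], which is divisible by [p] unless [j = p.-1]. *)
Lemma sum_DeltaX phi v y : (\sum_x phi (rcons v x))%R = DeltaX p.-1 phi (rcons v y).
Proof.
rewrite (reindex_inj (addrI y)) sum_Fp.
transitivity (\sum_(i < p) \sum_(j < p) DeltaX j phi (rcons v y) *+ 'C(i, j))%R.
  apply: eq_bigr => i _; rewrite -iter_shift_last Newton_shift.
  rewrite (big_ord_widen _ (fun j => DeltaX j phi (rcons v y) *+ 'C(i, j))%R (ltn_ord i)).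
  rewrite big_mkcond; apply: eq_bigr => j _.
  by case: ltnP => // ij; rewrite bin_small // mulr0n.
rewrite exchange_big; under eq_bigr => j _ do rewrite sumrMnr sum_bin.
suff h n (D : nat -> 'F_p) : n = p -> (\sum_(j < n) D j *+ 'C(n, j.+1) = D n.-1)%R.
  exact: (h p (fun j => DeltaX j phi (rcons v y))).
case: n => [|n] np; first by have := prime_gt0 pp; rewrite -[X in (_ < X)%N]np.
rewrite big_ord_recr /= big1 => [|j _]; first by rewrite binn add0r.
have /dvdnP[m ->] : p %| 'C(n.+1, j.+1).
  by rewrite np; apply: prime_dvd_bin => //; rewrite /= -np ltnS ltn_ord.
by rewrite mulrnA -(mulr_natr _ p) pchar_Fp_0 // mulr0.
Qed.

End Labels.

(** * Uniseriality of the permutation module of a level *)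

Section Uniserial.
Variable p : nat.
Hypothesis pp : prime p.
Variable G : set (autT 'F_p).
Hypothesis Gshift : G `<=` @shifting p.
Hypothesis Glab : forall k, exists2 g, G g & lab_sum k g != 0%R.
Implicit Types (g h : autT 'F_p) (u v w : seq 'F_p) (phi psi : seq 'F_p -> 'F_p).

Local Notation DeltaX e := (iter e (@Delta p)).

Lemma Delta0_rcons phi v x : Delta phi = (fun=> 0%R) -> phi (rcons v x) = phi (rcons v 0%R).
Proof.
move=> d0; rewrite -[x]natr_Zp; elim: (x : nat) => [//|i <-].
have := congr1 (fun D => D (rcons v i%:R)%R) d0.
by rewrite /Delta shift_last_rcons natr1 => /eqP; rewrite subr_eq0 => /eqP.
Qed.

Definition fiber phi u : 'F_p := phi (rcons u 0%R).

Lemma Delta_fiber_eq0 m phi : level_fun m.+1 phi -> Delta phi = (fun=> 0%R) ->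
  (forall u, fiber phi u = 0%R) -> phi = fun=> 0%R.
Proof.
move=> f0 d0 r0; apply: funext => w; case/lastP: w => [|v x]; first exact: f0.
by rewrite Delta0_rcons //; apply: r0.
Qed.

(* The coefficients of degree [e] in the last letter of the elements of [M] of
   degree at most [e], [Delta] playing the role of the derivative. *)
Definition top e (M : set (seq 'F_p -> 'F_p)) : set (seq 'F_p -> 'F_p) :=
  [set fiber (DeltaX e phi) | phi in [set phi | M phi /\ DeltaX e.+1 phi = fun=> 0%R]].

Lemma top_submodule e m M : submodule G m.+1 M -> submodule G m (top e M).
Proof.
move=> [Mf M0 MB MG]; split.
- move=> _ [phi [/Mf f0 _] <-] w wm.
  by rewrite /fiber (DeltaX_fun e f0) // size_rcons.
- by exists (fun=> 0%R); [split=> //; exact: DeltaX0|rewrite DeltaX0].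
- move=> _ _ [phi [Mphi phi0] <-] [psi [Mpsi psi0] <-].
  exists (fun w => phi w - psi w)%R; last by rewrite DeltaXB.
  split; first exact: MB.
  by rewrite DeltaXB phi0 psi0; apply: funext => w; rewrite subr0.
- move=> h _ Gh [phi [Mphi phi0] <-]; have hS := Gshift Gh.
  exists (fun w => phi (h w)).
    split; first exact: MG.
    by rewrite DeltaX_act // phi0.
  rewrite DeltaX_act //; apply: funext => u; rewrite /fiber hS.
  by rewrite Delta0_rcons.
Qed.

(** These are the consequences of uniseriality carried by the induction; the last two describe the
    smallest nonzero submodule and the largest proper one. *)
Definition uniserial m := forall M, submodule G m M ->
  [/\ cyclic_module G m M,
      forall phi, M phi -> phi <> (fun=> 0%R) -> M (@level_cst p m)
    & forall phi, M phi -> level_sum m phi != 0%R -> level_fun m `<=` M].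

Lemma level_sum0 m : level_sum m (fun _ : seq 'F_p => 0%R) = 0%R.
Proof. by elim: m => [//|m IH] /=; rewrite -[RHS]IH; apply: eq_level_sum => u _; rewrite big1. Qed.

(* If [DeltaX e.+1 phi'] is constant [1], then [phi' \o g - phi'] is killed by
   [DeltaX e.+1] and its image under [DeltaX e] has total [lab_sum m g]; choosing
   [g] with [lab_sum m g != 0] allows a descent on [e]. *)
Lemma submodule_ker_DeltaX m e M phi : uniserial m -> submodule G m.+1 M -> M phi ->
    DeltaX e phi <> (fun=> 0%R) -> DeltaX e.+1 phi = (fun=> 0%R) ->
  forall k, level_fun m.+1 k -> DeltaX e k = (fun=> 0%R) -> M k.
Proof.
move=> um sM; elim: e phi => [|e IH] phi Mphi phiN phi0 k kf k0.
  by rewrite (_ : k = fun=> 0%R) //; case: sM.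
have [Mf M0 MB MG] := sM.
have [_ topc _] := um _ (top_submodule e.+1 sM).
have [phi' [Mphi' phi'0] phi'E] : top e.+1 M (@level_cst p m).
  apply: (topc (fiber (DeltaX e.+1 phi))); first by exists phi.
  move=> r0; apply: phiN; apply: (Delta_fiber_eq0 (m := m)) => // [|u].
    exact/DeltaX_fun/Mf.
  by rewrite r0.
pose d := DeltaX e phi'.
(* [Delta d] is [1] on level [m.+1], so [d] is affine of slope [1] in the last letter. *)
have dE u (i : nat) : size u = m -> d (rcons u i%:R)%R = (d (rcons u 0) + i%:R)%R.
  move=> um'; elim: i => [|i IHi]; first by rewrite addr0.
  have : Delta d (rcons u i%:R)%R = 1%R.
    rewrite Delta0_rcons //.
    have := congr1 (fun D => D u) phi'E; rewrite /fiber iterS => ->.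
    by rewrite /level_cst um' eqxx.
  by rewrite /Delta shift_last_rcons natr1 IHi => /eqP; rewrite subr_eq => /eqP ->;
     rewrite -natr1; ring.
have [g Gg gN] := Glab m; have gS := Gshift Gg.
pose gam w := (phi' (g w) - phi' w)%R.
have Mgam : M gam by apply: MB => //; apply: MG.
have gamE : DeltaX e gam = fun w => (d (g w) - d w)%R by rewrite DeltaXB DeltaX_act.
have gam0 : DeltaX e.+1 gam = fun=> 0%R.
  rewrite DeltaXB DeltaX_act //; apply: funext => w.
  case/lastP: w => [|u x]; first by rewrite act_root subrr.
  have phi'R v y : DeltaX e.+1 phi' (rcons v y) = level_cst m v.
    by rewrite -phi'E; apply: Delta0_rcons.
  rewrite gS !phi'R.
  by rewrite /level_cst size_act subrr.
(* By the slope of [d], its composite with [g] has fibre [fiber d (g u) + lab g u] at [u], and the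
   first term has the same total as [fiber d]. *)
have gamT : level_sum m (fiber (DeltaX e gam)) != 0%R.
  rewrite gamE (_ : level_sum m _ = lab_sum m g) //.
  apply: (addIr (level_sum m (fiber d))).
  rewrite -[in RHS](level_sum_act m (fiber d) gS) -!level_sumD.
  apply: eq_level_sum => u un; rewrite /fiber gS add0r -[lab g u]natr_Zp dE ?size_act //.
  by ring.
have [_ _ topT] := um _ (top_submodule e sM).
have allT : level_fun m `<=` top e M.
  by apply: topT gamT; exists gam.
have gamN : DeltaX e gam <> fun=> 0%R.
  by move=> g0; move: gamT; rewrite g0 level_sum0 eqxx.
(* [k'] cancels the coefficient of degree [e] of [k], so the difference falls under the induction
   hypothesis with [gam]. *)
have [k' [Mk' k'0] k'E] : top e M (fiber (DeltaX e k)).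
  by apply: allT => u um'; rewrite /fiber (DeltaX_fun e kf) // size_rcons.
apply: (submodule_subK sM Mk'); apply: (IH gam) => //.
  by move=> w wm; rewrite kf // (Mf _ Mk') // subr0.
rewrite DeltaXB; apply: (@Delta_fiber_eq0 m).
- by move=> w wm; rewrite !(@DeltaX_fun _ m.+1) ?subr0 //; exact: Mf.
- rewrite -DeltaXB -iterS DeltaXB k'0.
  by move: k0; rewrite /= => ->; apply: funext => w; rewrite subr0.
- by move=> u; have := congr1 (fun D => D u) k'E; rewrite /fiber => ->; rewrite subrr.
Qed.

Lemma submodule0_full M phi : submodule G 0 M -> M phi -> phi <> (fun=> 0%R) ->
  level_fun 0 `<=` M.
Proof.
move=> sM Mphi phiN k k0; have [Mf _ _ _] := sM.
have phi0 : phi [::] != 0%R.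
  apply/eqP => e; apply: phiN; apply: funext => -[//|x w].
  by apply: Mf.
have := submoduleMn (k [::] / phi [::])%R sM Mphi; congr M.
apply: funext => -[|x w]; last by rewrite (Mf _ Mphi (x :: w)) // (k0 (x :: w)) // mul0rn.
by rewrite -mulr_natr natr_Zp mulrC divfK.
Qed.

Lemma uniserial0 : uniserial 0.
Proof.
move=> M sM; have [Mf M0 _ _] := sM.
have full := submodule0_full sM.
split.
- have [[phi Mphi phiN]|all0] := pselect (exists2 phi, M phi & phi <> fun=> 0%R).
    by exists phi => // M' sM' M'phi k /Mf; apply: (submodule0_full sM' M'phi).
  exists (fun=> 0%R) => // M' [_ M'0 _ _] _ k Mk.
  have [-> //|kN] := pselect (k = fun=> 0%R).
  by case: all0; exists k.
- by move=> phi Mphi phiN; apply: (full phi) => // w; rewrite /level_cst => /negbTE ->.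
- move=> phi Mphi phiN; apply: (full phi) => // e.
  by move: phiN; rewrite e eqxx.
Qed.

(** The maximal [e] is the degree of [M] in the last letter, bounded because of [DeltaXp]. *)
Lemma exists_max_DeltaX (M : set (seq 'F_p -> 'F_p)) phi : M phi -> phi <> (fun=> 0%R) ->
  exists e, [/\ (e < p)%N, exists2 psi, M psi & DeltaX e psi <> (fun=> 0%R)
    & forall psi, M psi -> DeltaX e.+1 psi = fun=> 0%R].
Proof.
move=> Mphi phiN.
pose P e := `[< exists2 psi, M psi & DeltaX e psi <> fun=> 0%R >].
have P0 : exists e, P e by exists 0%N; apply/asboolP; exists phi.
have Pb e : P e -> (e <= p)%N.
  move=> /asboolP[psi _]; apply: contra_notT; rewrite -ltnNge => /ltnW/subnK <-.
  by rewrite iterD DeltaXp // DeltaX0.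
have [e /asboolP Pe emax] := ex_maxnP P0 Pb; exists e; split=> //.
  rewrite ltn_neqAle Pb ?andbT; last exact/asboolP.
  by case: Pe => psi _; apply: contra_notN => /eqP ->; rewrite DeltaXp.
move=> psi Mpsi; apply: contrapT => psiN.
have /emax : P e.+1 by apply/asboolP; exists psi.
by rewrite ltnn.
Qed.

(** By [submodule_ker_DeltaX], a submodule of degree [e] in the last letter contains all functions
    of lower degree. So membership is decided by the top coefficients, where level [m] is known. *)
Lemma uniserialS m : uniserial m -> uniserial m.+1.
Proof.
move=> um M sM; have [Mf M0 MB MG] := sM.
split.
- have [[phi0 Mphi0 phi0N]|all0] := pselect (exists2 phi, M phi & phi <> fun=> 0%R); last first.
    exists (fun=> 0%R) => // M' [_ M'0 _ _] _ k Mk.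
    have [-> //|kN] := pselect (k = fun=> 0%R).
    by case: all0; exists k.
  have [e [_ [psi Mpsi psiN] e0]] := exists_max_DeltaX Mphi0 phi0N.
  have [[_ [phi [Mphi _] <-] cyc] _ _] := um _ (top_submodule e sM).
  (* Were [DeltaX e phi] zero, all top coefficients, generated by that of [phi], would vanish,
     against the choice of [e]. *)
  have phiN : DeltaX e phi <> fun=> 0%R.
    move=> ez; apply: psiN; apply: (Delta_fiber_eq0 (m := m)) => [||u].
    - exact/DeltaX_fun/Mf.
    - exact: e0.
    - have : [set (fun _ : seq 'F_p => 0%R : 'F_p)] (fiber (DeltaX e psi)).
        apply: (cyc _ (submodule_zero G m)); first by rewrite /= ez.
        by exists psi => //; split=> //; apply: e0.
      by rewrite /= => ->.
  exists phi => // M' sM' M'phi k Mk.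
  have [k' [M'k' k'0] k'E] : top e M' (fiber (DeltaX e k)).
    apply: (cyc _ (top_submodule e sM')); first by exists phi => //; split=> //; apply: e0.
    by exists k => //; split=> //; apply: e0.
  have [M'f _ _ _] := sM'.
  apply: (submodule_subK sM' M'k').
  apply: (submodule_ker_DeltaX um sM' M'phi phiN) => //; first exact: e0.
    by move=> w wm; rewrite (Mf _ Mk) // (M'f _ M'k') // subr0.
  rewrite DeltaXB; apply: (@Delta_fiber_eq0 m).
  + by move=> w wm; rewrite !(@DeltaX_fun _ m.+1) ?subr0 //; [exact: M'f|exact: Mf].
  + rewrite -DeltaXB -iterS DeltaXB k'0 e0 //.
    by apply: funext => w; rewrite subr0.
  + by move=> u; have := congr1 (fun D => D u) k'E; rewrite /fiber => ->; rewrite subrr.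
- move=> phi Mphi phiN.
  have cst_fun : level_fun m.+1 (@level_cst p m.+1).
    by move=> w /negbTE; rewrite /level_cst => ->.
  have cst0 : Delta (@level_cst p m.+1) = fun=> 0%R.
    by apply: funext => w; rewrite /Delta /level_cst size_shift_last subrr.
  have [e [_ [psi -> psiN] e0]] := @exists_max_DeltaX [set phi] phi erefl phiN.
  have {}e0 := e0 phi erefl.
  (* In positive degree the constant has lower degree than [phi]; in degree [0] the function [phi]
     comes from level [m]. *)
  case: e e0 psiN => [|e] e0 psiN; last first.
    apply: (submodule_ker_DeltaX um sM Mphi psiN e0) => //.
    by rewrite iterSr cst0 DeltaX0.
  have [_ topc _] := um _ (top_submodule 0 sM).
  have [k [Mk k0] kE] : top 0 M (@level_cst p m).
    apply: (topc (fiber phi)); first by exists phi.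
    move=> r0; apply: phiN; apply: (Delta_fiber_eq0 (m := m)) => // [|u]; first exact: Mf.
    by rewrite r0.
  rewrite (_ : level_cst m.+1 = k) //; apply: funext => w.
  case/lastP: w => [|u x]; first by rewrite (Mf _ Mk).
  rewrite (Delta0_rcons _ _ k0) -/(fiber k u); have := congr1 (fun D => D u) kE => /= ->.
  by rewrite /level_cst size_rcons.
- move=> phi Mphi phiT k kf.
  have p0 : p.-1.+1 = p by rewrite prednK // prime_gt0.
  (* Summing over the last letter first leaves the coefficient of degree [p.-1], so the condition on
     totals passes to level [m]. *)
  have phiT' : level_sum m (fiber (DeltaX p.-1 phi)) != 0%R.
    move: phiT; rewrite /=; congr (_ != _); apply: eq_level_sum => u _.
    exact: sum_DeltaX.
  have phi0 psi : DeltaX p.-1.+1 psi = fun=> 0%R by rewrite p0 DeltaXp.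
  have [_ _ topT] := um _ (top_submodule p.-1 sM).
  have [k' [Mk' k'0] k'E] : top p.-1 M (fiber (DeltaX p.-1 k)).
    apply: (topT _ _ phiT'); first by exists phi => //; split.
    by move=> u um'; rewrite /fiber (DeltaX_fun p.-1 kf) // size_rcons.
  apply: (submodule_subK sM Mk').
  apply: (submodule_ker_DeltaX um sM Mphi (e := p.-1)) => //.
  + by move=> e0; move: phiT'; rewrite e0 level_sum0 eqxx.
  + by move=> w wm; rewrite kf // (Mf _ Mk') // subr0.
  rewrite DeltaXB; apply: (@Delta_fiber_eq0 m).
  + by move=> w wm; rewrite !(@DeltaX_fun _ m.+1) ?subr0 //; exact: Mf.
  + by rewrite -DeltaXB -iterS phi0.
  + by move=> u; have := congr1 (fun D => D u) k'E; rewrite /fiber => ->; rewrite subrr.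
Qed.

Lemma level_uniserial m : uniserial m.
Proof. by elim: m => [|m]; [exact: uniserial0|exact: uniserialS]. Qed.

End Uniserial.

(** * Filtrations with uniserial layers *)

Section Layers.
Variable p : nat.
Hypothesis pp : prime p.
Variable G : set (autT 'F_p).
Hypothesis sG : is_subgroup G.
Hypothesis Gshift : G `<=` @shifting p.
Hypothesis Glab : forall k, exists2 g, G g & lab_sum k g != 0%R.
Hypothesis Gsection : forall u g, G g -> G (section u g).
Implicit Types (g h x y : autT 'F_p) (u w : seq 'F_p) (N H K : set (autT 'F_p)).

(** The second clause costs one normal generator, the third a factor [p] in the index of
    [commg_group N G]. *)
Definition layer N N' := exists v, [/\ N v,
  forall x, N x -> exists2 y, normal_closure G [set v] y & N' (y^-1 * x)
  & forall x, N x -> exists i, exists2 y, (i < p)%N /\ commg_group N G y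
      & N' ((v ^+ i * y)^-1 * x)].

Fixpoint layers k N N' := if k is k'.+1
  then exists N1, [/\ normal_in G N1, N1 `<=` N, layer N N1 & layers k' N1 N']
  else N = N'.

Lemma layers_generate k N N' : normal_in G N -> layers k N N' ->
  exists s : seq (autT 'F_p), [/\ size s = k, forall v, v \in s -> N v
    & forall x, N x -> exists2 y, normal_closure G [set` s] y & N' (y^-1 * x)].
Proof.
elim: k N => [|k IH] N nN /=.
  move=> <-; exists [::]; split=> // x Nx; exists 1; last by rewrite invg1 mul1g.
  have nil_sub : [set` [::]] `<=` G by move=> ?.
  by have [/subgroup1] := normal_closure_normal sG nil_sub.
case=> N1 [nN1 N1N [v [Nv genv _]]] /(IH _ nN1)[s [sk sN1 gens]].
have [_ NG _] := nN.
exists (v :: s); split; first by rewrite /= sk.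
  by move=> t; rewrite in_cons => /predU1P[->|/sN1/N1N].
have vsG : [set` v :: s] `<=` G.
  by move=> t /=; rewrite in_cons => /predU1P[->|/sN1/N1N/NG]; first exact: NG.
have [sC _ _] := normal_closure_normal sG vsG.
move=> x Nx; have [y yv N1y] := genv x Nx; have [z zs N'z] := gens _ N1y.
exists (y * z); last by rewrite invgM -mulgA.
apply: (subgroupM sC).
  by apply: normal_closure_mono yv => _ ->; rewrite /= mem_head.
by apply: normal_closure_mono zs => t /=; rewrite in_cons orbC => ->.
Qed.

Lemma layers_cover k N N' : normal_in G N -> layers k N N' ->
  exists s : seq (autT 'F_p), [/\ (size s <= p ^ k)%N, forall d, d \in s -> G d &
    forall x, N x -> exists2 d, d \in s & exists2 y, commg_group N G y & N' ((d * y)^-1 * x)].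
Proof.
elim: k N => [|k IH] N nN /=.
  move=> <-; exists [:: 1]; split=> // [d|x Nx].
    by rewrite inE => /eqP ->; apply: subgroup1.
  exists 1; rewrite ?mem_head //.
  exists 1; first exact: (subgroup1 (gen_by_subgroup _)).
  by rewrite mul1g invg1 mul1g.
case=> N1 [nN1 N1N [v [Nv _ covv]]] /(IH _ nN1)[s [sk sG' covs]].
have [_ NG _] := nN.
exists [seq v ^+ i * d | i <- iota 0 p, d <- s]; split.
- by rewrite size_allpairs size_iota expnS leq_mul2l sk orbT.
- move=> _ /allpairsP[[i d] [/= _ ds ->]]; apply: subgroupM => //; last exact: sG'.
  by apply: subgroupX => //; apply: NG.
move=> x Nx; have [i [y [ip Cy] N1x]] := covv x Nx.
have [d ds [z Cz N'z]] := covs _ N1x.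
have [sC _ nC] := commg_group_normal sG nN.
exists (v ^+ i * d).
  by apply/allpairsP; exists (i, d); split; rewrite //= mem_iota.
(* Moving [d] past [y] turns [y] into [y ^ d], which stays in the commutator subgroup. *)
exists (y ^ d * z).
  apply: (subgroupM sC); first by apply: nC => //; apply: sG'.
  exact: commg_group_mono Cz.
have -> // : (v ^+ i * d * (y ^ d * z))^-1 * x = (d * z)^-1 * ((v ^+ i * y)^-1 * x).
by rewrite /conjg !gnorm.
Qed.

Section Homomorphism.
Variables (N H : set (autT 'F_p)) (n : nat) (chi : autT 'F_p -> 'F_p).
Hypothesis nN : normal_in G N.
Hypothesis Nstab : N `<=` @level_stab _ n.
Hypothesis NH : forall x w, N x -> size w = n -> H (section w x).
Hypothesis chiM : forall x y, H x -> H y -> chi (x * y) = (chi x + chi y)%R.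
Hypothesis chiJ : forall x h, H x -> G h -> chi (x ^ h) = chi x.

(** With [chi] a [G]-invariant homomorphism, this embeds [N] modulo [hom_ker] into the functions on
    level [n], compatibly with [G]. *)
Definition level_map x w : 'F_p := if size w == n then chi (section w x) else 0%R.

Lemma level_mapM x y : N x -> N y ->
  level_map (x * y) = fun w => (level_map x w + level_map y w)%R.
Proof.
move=> Nx Ny; apply: funext => w; rewrite /level_map; case: eqP => [wn|]; last by rewrite addr0.
by rewrite sectionM (Nstab Nx) // chiM //; apply: NH.
Qed.

Lemma level_map1 : level_map 1 = fun=> 0%R.
Proof.
have [sN _ _] := nN; have N1 := subgroup1 sN.
apply: funext => w; have /(congr1 (fun F => F w)) := level_mapM N1 N1.
by rewrite mulg1 -[X in X = _]addr0 => /addrI.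
Qed.

Lemma level_mapV x : N x -> level_map x^-1 = fun w => (- level_map x w)%R.
Proof.
have [sN _ _] := nN; move=> Nx; apply: funext => w.
have := level_mapM Nx (subgroupV sN Nx); rewrite mulgV level_map1.
by move/(congr1 (fun F => F w))/esym/eqP; rewrite addrC addr_eq0 => /eqP.
Qed.

Lemma level_mapX x i : N x -> level_map (x ^+ i) = fun w => (level_map x w *+ i)%R.
Proof.
have [sN _ _] := nN; move=> Nx; elim: i => [|i IH]; first exact: level_map1.
rewrite expgS level_mapM ?IH //; last exact: subgroupX.
by apply: funext => w; rewrite mulrS.
Qed.

Lemma level_mapJ x h w : N x -> G h -> level_map (x ^ h) (h w) = level_map x w.
Proof.
move=> Nx Gh; rewrite /level_map size_act; case: eqP => // wn.
rewrite sectionJ; last exact: Nstab.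
by rewrite chiJ //; [apply: NH|apply: Gsection].
Qed.

Lemma level_map_act x h : N x -> G h ->
  (fun w => level_map x (h w)) = level_map (x ^ h^-1).
Proof.
move=> Nx Gh; apply: funext => w.
have [_ _ nNG] := nN; have Gh' := subgroupV sG Gh.
by rewrite -(@level_mapJ (x ^ h^-1) h) ?conjgKV //; apply: (nNG).
Qed.

Lemma level_map_submodule (Q : set (autT 'F_p)) : normal_in G Q -> Q `<=` N ->
  submodule G n (level_map @` Q).
Proof.
move=> [sQ _ nQ] QN; split.
- by move=> _ [x Qx <-] w /negbTE wn; rewrite /level_map wn.
- by exists 1; rewrite ?level_map1 //; apply: subgroup1.
- move=> _ _ [x Qx <-] [y Qy <-]; exists (x * y^-1); first exact: sQ.2.
  rewrite level_mapM ?level_mapV //; try exact: QN.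
  by apply: QN; apply: subgroupV.
- move=> h _ Gh [x Qx <-]; exists (x ^ h^-1).
    by apply: (nQ) => //; apply: subgroupV.
  by rewrite level_map_act //; apply: QN.
Qed.

Definition hom_ker := [set x | N x /\ forall w, size w = n -> chi (section w x) = 0%R].

Lemma hom_kerP x : N x -> level_map x = (fun=> 0%R) -> hom_ker x.
Proof.
move=> Nx x0; split=> // w wn.
by have := congr1 (fun F => F w) x0; rewrite /level_map wn eqxx.
Qed.

(** The image of [N] is a submodule of a uniserial module, hence generated by the image of one [v].
    Any submodule containing that image is then large enough, in particular the image of the normal
    closure of [v]. *)
Lemma hom_layer : layer N hom_ker.
Proof.
have [sN NG nNG] := nN.
have [[_ [v Nv <-] cyc] _ _] := level_uniserial pp Gshift Glab (level_map_submodule nN (fun _ => id)).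
have nG x h : N x -> G h -> N (x ^ h) by move=> ? ?; apply: nNG.
have ker_of x y : N x -> N y -> level_map x = level_map y -> hom_ker (y^-1 * x).
  move=> Nx Ny e; have NyV := subgroupV sN Ny; apply: hom_kerP; first exact: subgroupM.
  by rewrite level_mapM // level_mapV // e; apply: funext => w; rewrite addNr.
exists v; split=> // x Nx.
  have vG : [set v] `<=` G by move=> _ ->; apply: NG.
  have nV := normal_closure_normal sG vG.
  have VN : normal_closure G [set v] `<=` N by apply: normal_closure_min => // _ ->.
  have [y Vy yx] : (level_map @` normal_closure G [set v]) (level_map x).
    apply: (cyc _ (level_map_submodule nV VN)); last by exists x.
    by exists v => //; apply: sub_normal_closure.
  by exists y => //; apply: ker_of => //; apply: VN.
have nC := commg_group_normal sG nN; have CN := commg_group_sub nN.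
have [sC _ nCG] := nC.
pose F i y := level_map (v ^+ i * y).
have FE i y : commg_group N G y -> F i y = fun w => (level_map v w *+ i + level_map y w)%R.
  move=> Cy; rewrite /F level_mapM ?level_mapX //; first exact: subgroupX.
  exact: CN.
(* [M] is spanned by [v] and the commutators; it is a submodule because [h] changes [v] only by the
   image of a commutator. *)
pose M := [set phi | exists i, exists2 y, commg_group N G y & phi = F i y].
have sM : submodule G n M.
  split.
  - by move=> _ [i [y Cy ->]] w /negbTE wn; rewrite /F /level_map wn.
  - exists 0%N, 1; first exact: (subgroup1 sC).
    rewrite FE ?level_map1; last exact: (subgroup1 sC).
    by apply: funext => w; rewrite mulr0n addr0.
  - move=> _ _ [i [y Cy ->]] [j [z Cz ->]].
    exists (i + p.-1 * j)%N, (y * z^-1); first exact: sC.2.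
    have CzV := subgroupV sC Cz.
    rewrite !FE //; last exact: (subgroupM sC).
    rewrite level_mapM ?level_mapV //; try exact: CN.
    apply: funext => w; rewrite mulrnDr mulrnA.
    have -> : (level_map v w *+ p.-1 = - level_map v w)%R.
      apply/eqP; rewrite -addr_eq0 -mulrSr prednK ?prime_gt0 //.
      by rewrite -mulr_natr pchar_Fp_0 // mulr0.
    by rewrite mulNrn; ring.
  - move=> h _ Gh [i [y Cy ->]]; have Gh' := subgroupV sG Gh.
    exists i, ([~ v, h^-1] ^+ i * y ^ h^-1).
      apply: (subgroupM sC); last exact: nCG.
      by apply: (subgroupX _ sC); apply: commg_groupP.
    have Ncv : N [~ v, h^-1] by apply: normal_commgl nN _ _.
    have NcvX : N ([~ v, h^-1] ^+ i) by apply: subgroupX.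
    rewrite !FE //; last first.
      apply: (subgroupM sC); last exact: nCG.
      by apply: (subgroupX _ sC); apply: commg_groupP.
    have Ny := CN _ Cy.
    rewrite level_mapM //; last exact: nG.
    rewrite level_mapX // -level_map_act // commgEl level_mapM //; try exact: nG; last exact: subgroupV.
    rewrite level_mapV // -level_map_act //; apply: funext => w.
    by rewrite mulrnDl mulNrn; ring.
have [|i [y Cy xE]] := cyc M sM _ (level_map x) (ex_intro2 _ _ x Nx erefl).
  exists 1%N, 1; first exact: (subgroup1 sC).
  by rewrite /F expg1 mulg1.
have Ny := CN _ Cy.
exists (i %% p)%N, y; first by split=> //; rewrite ltn_mod prime_gt0.
apply: ker_of => //; first by apply: subgroupM => //; apply: subgroupX.
rewrite xE -/(F _ _) !FE //; apply: funext => w.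
by rewrite -[in RHS]mulr_natr Fp_nat_mod // mulr_natr.
Qed.

End Homomorphism.

Definition sections_in N n H := [set x | N x /\ forall w, size w = n -> H (section w x)].

Lemma sections_in_normal N n H : normal_in G N -> N `<=` @level_stab _ n ->
  normal_in G H -> normal_in G (sections_in N n H).
Proof.
move=> [sN NG nN] NS [sH HG nH]; split.
- split=> [|x y [Nx Hx] [Ny Hy]].
    by split=> [|w _]; [exact: subgroup1|rewrite section1; exact: subgroup1].
  split=> [|w wn]; first exact: sN.2.
  have := sectionV w y; rewrite (NS y Ny) // => yV.
  by rewrite sectionM (NS x Nx) // yV; apply: sH.2; [apply: Hx|apply: Hy].
- by move=> x [/NG].
- move=> g x Gg [Nx Hx]; split=> [|w wn]; first exact: nN.
  rewrite -[w](Defs.actKV g) sectionJ; last by apply: (NS x Nx); rewrite size_act.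
  by apply: nH; [exact: Gsection|apply: Hx; rewrite size_act].
Qed.

(** The homomorphism is the exponent of [c] modulo [H], well defined in 'F_p because [c] outside [H]
    has order [p] modulo [H]. For [c] in [H] the layer is trivial. *)
Lemma cyclic_ext_layer N n H c : normal_in G N -> N `<=` @level_stab _ n ->
    normal_in G H -> G c -> (forall g, G g -> H [~ c, g]) -> H (c ^+ p) ->
    (forall x w, N x -> size w = n -> cyclic_ext H c (section w x)) ->
  layer N (sections_in N n H).
Proof.
move=> nN NS nH Gc Hc Hp NE; have [sH HG nHG] := nH; have [sN _ _] := nN.
have [cH|cH] := pselect (H c).
  have N'N x : N x -> sections_in N n H (1^-1 * x).
    move=> Nx; rewrite invg1 mul1g; split=> // w wn.
    have [i Hi] := NE _ _ Nx wn; apply: subgroup_divl Hi => //.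
    by apply: subgroupV => //; apply: subgroupX.
  have oneG : [set 1] `<=` G by move=> _ ->; apply: subgroup1.
  exists 1; split=> [|x Nx|x Nx]; first exact: subgroup1.
    exists 1; last exact: N'N.
    by have [/subgroup1] := normal_closure_normal sG oneG.
  exists 0%N, 1; last by rewrite mulg1; apply: N'N.
  by split; [exact: prime_gt0|exact: (subgroup1 (gen_by_subgroup _))].
have expc i : H (c ^+ i) -> (i%:R = 0 :> 'F_p)%R.
  move=> Hi; apply/eqP; rewrite -(dvdn_pcharf (pchar_Fp pp)).
  by apply: contra_notT cH; rewrite -prime_coprime // => /(subgroup_expg_inj sH); apply.
have exp_uniq x i j : H (c ^- i * x) -> H (c ^- j * x) -> (i%:R = j%:R :> 'F_p)%R.
  wlog ij : i j / (i <= j)%N.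
    by move=> h Hi Hj; case/orP: (leq_total i j) => ij; [|apply/esym]; apply: h.
  move=> Hi Hj; rewrite -(subnK ij) natrD (expc (j - i)%N) ?add0r //.
  have -> : c ^+ (j - i) = ((c ^- j * x) * (c ^- i * x)^-1)^-1.
    by rewrite !gnorm -[in RHS](subnKC ij) expgnDr mulKg.
  by apply: subgroupV => //; apply: sH.2.
(* Any exponent may be chosen; the default [0] is taken only outside the extension. *)
pose chi x : 'F_p := let i := xget 0%N [set i | H (c ^- i * x)] in i%:R%R.
have chiE x i : H (c ^- i * x) -> chi x = i%:R%R.
  move=> Hi; rewrite /chi; case: xgetP => [j _ Hj|/(_ i)//].
  exact: exp_uniq Hj Hi.
have chiM x y : cyclic_ext H c x -> cyclic_ext H c y -> chi (x * y) = (chi x + chi y)%R.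
  move=> [i Hi] [j Hj]; rewrite (chiE _ _ Hi) (chiE _ _ Hj) -natrD.
  apply: chiE; have -> : c ^- (i + j) * (x * y) = (c ^- i * x) ^ (c ^+ j) * (c ^- j * y).
    by rewrite expgnDr /conjg !gnorm.
  by apply: subgroupM => //; apply: nHG => //; apply: subgroupX.
have chiJ x h : cyclic_ext H c x -> G h -> chi (x ^ h) = chi x.
  move=> Ex Gh; have [i Hi] := Ex; rewrite (chiE _ _ Hi).
  apply: chiE; have -> : c ^- i * x ^ h = (c ^- i * x) * [~ x, h].
    by rewrite /commg /conjg !gnorm.
  by apply: subgroupM => //; apply: (commg_cyclic_ext sG nH Gc Hc Ex).
have [v [Nv gv cv]] := hom_layer nN NS NE chiM chiJ.
have kerN x : hom_ker N n chi x -> sections_in N n H x.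
  move=> [Nx x0]; split=> // w wn.
  have [i Hi] := NE _ _ Nx wn; have := x0 _ wn.
  rewrite (chiE _ _ Hi) => /eqP; rewrite -(dvdn_pcharf (pchar_Fp pp)) => /dvdnP[m im].
  apply: subgroup_divl Hi => //; apply: subgroupV => //.
  by rewrite im mulnC expgnA; apply: subgroupX.
exists v; split=> // x Nx.
  by have [y Vy /kerN] := gv x Nx; exists y.
by have [i [y iy /kerN]] := cv x Nx; exists i, y.
Qed.

Lemma layers_cat k l N N1 N2 : layers k N N1 -> layers l N1 N2 -> layers (k + l) N N2.
Proof.
elim: k N => [|k IH] N /=; first by move=> ->.
by move=> [N0 [nN0 N0N l0 lk]] lN; exists N0; split=> //; apply: IH.
Qed.

Definition cyclic_exts (cs : seq (autT 'F_p)) K := foldr (fun c H => cyclic_ext H c) K cs.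

Lemma cyclic_exts_normal cs K : normal_in G K ->
    (forall c, c \in cs -> [/\ G c, forall g, G g -> K [~ c, g] & K (c ^+ p)]) ->
  normal_in G (cyclic_exts cs K) /\ K `<=` cyclic_exts cs K.
Proof.
move=> nK; elim: cs => [|c cs IH] cP; first by split.
have [|nH KH] := IH; first by move=> d ds; apply: cP; rewrite in_cons ds orbT.
have [Gc Kc Kp] := cP c (mem_head _ _).
split; last by move=> x /KH; apply: sub_cyclic_ext.
by apply: (cyclic_ext_normal (p := p)) => //; [exact: prime_gt0|move=> h /Kc/KH|exact: KH].
Qed.

(** The head of the list is the outermost extension. Each layer strips it, since centrality modulo
    [K] persists modulo the inner extension. *)
Lemma cyclic_exts_layers cs N n K : normal_in G N -> N `<=` @level_stab _ n ->
    normal_in G K ->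
    (forall c, c \in cs -> [/\ G c, forall g, G g -> K [~ c, g] & K (c ^+ p)]) ->
    (forall x w, N x -> size w = n -> cyclic_exts cs K (section w x)) ->
  layers (size cs) N (sections_in N n K).
Proof.
move=> nN NS nK; elim: cs N nN NS => [|c cs IH] N nN NS cP NE.
  by rewrite /= eqEsubset; split=> [x Nx|x []//]; split=> // w; apply: NE.
have csP d : d \in cs -> [/\ G d, forall g, G g -> K [~ d, g] & K (d ^+ p)].
  by move=> ds; apply: cP; rewrite in_cons ds orbT.
have [nH KH] := cyclic_exts_normal nK csP.
have [Gc Kc Kp] := cP c (mem_head _ _).
exists (sections_in N n (cyclic_exts cs K)); split.
- exact: sections_in_normal.
- by move=> x [].
- by apply: cyclic_ext_layer NE => //; [move=> g /Kc/KH|exact: KH].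
have <- : sections_in (sections_in N n (cyclic_exts cs K)) n K = sections_in N n K.
  rewrite eqEsubset; split=> x; first by move=> [[Nx _] Kx].
  by move=> [Nx Kx]; split=> //; split=> // w /Kx/KH.
apply: IH => //; first exact: sections_in_normal.
- by move=> x [/NS].
- by move=> x w [_ Hx]; apply: Hx.
Qed.

(** The homomorphism is the label at the root, [lab_sum 0], on all of [G]. *)
Lemma level_layer N n : normal_in G N -> N `<=` @level_stab _ n ->
  layer N (N `&` @level_stab _ n.+1).
Proof.
move=> nN NS; have [sN NG nNG] := nN.
have NH x w : N x -> size w = n -> G (section w x) by move=> /NG Gx _; apply: Gsection.
have M x y : G x -> G y -> lab_sum 0 (x * y) = (lab_sum 0 x + lab_sum 0 y)%R.
  by move=> Gx Gy; apply: lab_sumM; apply: Gshift.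
have lab0 x : G x -> lab_sum 0 x^-1 = (- lab_sum 0 x)%R.
  move=> Gx; apply/eqP; rewrite -addr_eq0 -M //; last exact: subgroupV.
  by rewrite mulVg lab_sum1.
have J x h : G x -> G h -> lab_sum 0 (x ^ h) = lab_sum 0 x.
  move=> Gx Gh; rewrite /conjg !M ?lab0 //; last 2 first.
  - exact: subgroupV.
  - exact: subgroupM.
  by ring.
have [v [Nv gv cv]] := hom_layer nN NS NH M J.
have kerN x : hom_ker N n (lab_sum 0) x -> (N `&` @level_stab _ n.+1) x.
  move=> [Nx x0]; split=> //; apply: level_stab_lab; [exact/Gshift/NG|exact: NS|].
  by move=> w wn; have := x0 w wn; rewrite /lab_sum /= lab_section cats0.
exists v; split=> // x Nx.
  by have [y Vy /kerN] := gv x Nx; exists y.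
by have [i [y iy /kerN]] := cv x Nx; exists i, y.
Qed.

End Layers.

(** * Generators of a Sunic group *)

Section SunicGroup.
Variables (p r : nat) (f : {poly 'F_p}) (b : nat -> autT 'F_p).
Hypothesis pp : prime p.
Hypothesis r_gt0 : (0 < r)%N.
Hypothesis f0 : (f`_0 != 0)%R.
Hypothesis bP : directed_system r f b.
Implicit Types (g h x y : autT 'F_p) (u v w : seq 'F_p) (z : 'F_p).

Local Notation a := (sunic_a p).
Local Notation G := (sunic_group r b).

Definition directed_group := gen_by [set b i | i in [set i | (0 < i <= r)%N]].
Local Notation B := directed_group.

(** The letter [p] is encoded as [0], so this is the product of powers of the [b j] prescribed in
    the definition of [b r]. *)
Definition directed_last := section [:: 0%R] (b r).
Local Notation beta := directed_last.

Lemma act_a z v : a (z :: v) = (1 + z)%R :: v.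
Proof. by rewrite /= permE. Qed.

Lemma section_a z : section [:: z] a = 1.
Proof. by apply: autT_ext => v; apply: section_eq; rewrite !act_a. Qed.

Lemma act_aX i z v : (a ^+ i) (z :: v) = (i%:R + z)%R :: v.
Proof.
elim: i z => [|i IH] z; first by rewrite add0r.
by rewrite expgS Defs.actM act_a IH addrA natr1.
Qed.

Lemma a_expp : a ^+ p = 1.
Proof.
apply: autT_ext => -[|z v]; first by rewrite act_root.
by rewrite act_aX pchar_Fp_0 // add0r.
Qed.

Lemma section_aX i z : section [:: z] (a ^+ i) = 1.
Proof. by apply: autT_ext => v; apply: section_eq; rewrite !act_aX. Qed.

Lemma sunic_subgroup : is_subgroup G.
Proof. exact: gen_by_subgroup. Qed.

Lemma sunic_mem_a : G a.
Proof. by apply: sub_gen_by; left. Qed.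

Lemma sunic_mem_b i : (0 < i <= r)%N -> G (b i).
Proof. by move=> ir; apply: sub_gen_by; right; exists i. Qed.

Lemma directed_mem_b i : (0 < i <= r)%N -> B (b i).
Proof. by move=> ir; apply: sub_gen_by; exists i. Qed.

Lemma directed_subgroup : is_subgroup B.
Proof. exact: gen_by_subgroup. Qed.

Lemma directed_sub : B `<=` G.
Proof.
apply: gen_by_min; first exact: sunic_subgroup.
by move=> _ [i /= ir <-]; apply: sunic_mem_b.
Qed.

Lemma b_stab i : (0 < i <= r)%N -> level_stab 1 (b i).
Proof. by case: bP => + _ _; apply. Qed.

Lemma section_b i z : (0 < i < r)%N -> section [:: z] (b i) = if z == 0%R then b i.+1 else 1.
Proof. by case: bP => _ h _ /h /(congr1 (fun t => t z)). Qed.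

Lemma section_br z :
  section [:: z] (b r) = if z == 1%R then a else if z == 0%R then beta else 1.
Proof.
have [_ _ h] := bP; rewrite /beta -[LHS]/(psi (b r) z) -[section _ (b r)]/(psi (b r) 0%R) h.
by case: ifP => // z1; case: ifP => // /eqP ->; rewrite eq_sym oner_eq0.
Qed.

Lemma beta_prod : beta = \prod_(j < r) b j.+1 ^+ (- f`_j)%R.
Proof.
have [_ _ h] := bP; rewrite -[LHS]/(psi (b r) 0%R) h.
by rewrite eq_sym oner_eq0 eqxx.
Qed.

Lemma directed_mem_beta : B beta.
Proof.
have sB := directed_subgroup.
rewrite beta_prod; apply: (big_ind B) => [|x y Bx By|j _].
- exact: (subgroup1 sB).
- exact: (subgroupM sB).
- by apply: (subgroupX _ sB); apply: directed_mem_b; rewrite ltn_ord.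
Qed.

Lemma section_expg n x u : x u = u -> section u (x ^+ n) = section u x ^+ n.
Proof.
move=> xu; elim: n => [|n IH]; first exact: section1.
by rewrite !expgS sectionM xu IH.
Qed.

Lemma directed_sections : B `<=` [set x | [/\ level_stab 1 x,
  exists i : nat, section [:: 1%R] x = a ^+ i, B (section [:: 0%R] x)
  & forall z, z != 0%R -> z != 1%R -> section [:: z] x = 1]].
Proof.
have n10 : (1 == 0 :> 'F_p)%R = false by rewrite oner_eq0.
have n01 : (0 == 1 :> 'F_p)%R = false by rewrite eq_sym n10.
have sB := directed_subgroup; have sS := level_stab_subgroup 'F_p 1.
apply: gen_by_min.
  split.
    split; [exact: (subgroup1 sS)|by exists 0%N; rewrite section1| |].
      by rewrite section1; apply: (subgroup1 sB).
    by move=> z _ _; rewrite section1.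
  move=> x y [xS [i xi] x0 x1] [yS [j yj] y0 y1].
  have yV z : section [:: z] y^-1 = (section [:: z] y)^-1 by apply: sectionV_fix; apply: yS.
  have xyM z : section [:: z] (x * y^-1) = section [:: z] x * (section [:: z] y)^-1.
    by rewrite sectionM (xS [:: z]) // yV.
  split.
  - exact: sS.2.
  - exists (i + j * p.-1)%N; rewrite xyM xi yj expgnDr; congr (_ * _).
    apply/eqP; rewrite eq_sym -mulg_eq1 -expgnDr -{2}[j]muln1 -mulnDr addn1.
    by rewrite prednK ?prime_gt0 // mulnC expgnA a_expp expg1n.
  - by rewrite xyM; apply: sB.2.
  - by move=> z z0 z1; rewrite xyM x1 // y1 // mulgV.
move=> _ [i /= ir <-]; split; first exact: b_stab.
- have [ir'|ri] := ltnP i r; last have -> : i = r by lia.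
    by exists 0%N; rewrite section_b ?n10 //; lia.
  by exists 1%N; rewrite section_br eqxx.
- have [ir'|ri] := ltnP i r; last have -> : i = r by lia.
    by rewrite section_b ?eqxx; [apply: directed_mem_b; lia|lia].
  by rewrite section_br n01 eqxx; apply: directed_mem_beta.
- move=> z /negbTE z0 /negbTE z1.
  have [ir'|ri] := ltnP i r; last have -> : i = r by lia.
    by rewrite section_b ?z0 //; lia.
  by rewrite section_br z0 z1.
Qed.

Lemma level_stab_eq1 x : (forall n, level_stab n x) -> x = 1.
Proof. by move=> xS; apply: autT_ext => u; apply: (xS (size u)). Qed.

(** Level by level: at the letter [1] the sections are powers of [a], at [0] they lie in [B] again,
    elsewhere they are trivial. *)
Lemma directed_commute x y : B x -> B y -> [~ x, y] = 1.
Proof.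
move=> Bx By; apply: level_stab_eq1 => n.
elim: n x y Bx By => [|n IH] x y Bx By; first by move=> [|//] _; apply: act_root.
have [xS [i xi] x0 x1] := directed_sections Bx.
have [yS [j yj] y0 y1] := directed_sections By.
have sS := level_stab_subgroup 'F_p 1.
apply: (@level_stab_cat _ 1) => [|[|z []] //= _]; first exact: (subgroupR sS).
have -> : section [:: z] [~ x, y] = [~ section [:: z] x, section [:: z] y].
  by rewrite sectionR //; [exact: xS|exact: yS].
have [->|z0] := eqVneq z 0%R; first exact: IH.
have [->|z1] := eqVneq z 1%R.
  rewrite xi yj (_ : [~ _, _] = 1); first exact: (subgroup1 (level_stab_subgroup _ _)).
  by apply/eqP/commgP; apply: commuteX2.
by rewrite x1 // comm1g; apply: (subgroup1 (level_stab_subgroup _ _)).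
Qed.

Lemma directed_expp x : B x -> x ^+ p = 1.
Proof.
move=> Bx; apply: level_stab_eq1 => n.
elim: n x Bx => [|n IH] x Bx; first by move=> [|//] _; apply: act_root.
have [xS [i xi] x0 x1] := directed_sections Bx.
apply: (@level_stab_cat _ 1) => [|[|z []] //= _].
  exact: (subgroupX _ (level_stab_subgroup _ _)).
rewrite section_expg; last exact: xS.
have [->|z0] := eqVneq z 0%R; first exact: IH.
have [->|z1] := eqVneq z 1%R.
  rewrite xi -expgnA mulnC expgnA a_expp expg1n.
  exact: (subgroup1 (level_stab_subgroup _ _)).
by rewrite x1 // expg1n; apply: (subgroup1 (level_stab_subgroup _ _)).
Qed.

Lemma beta_mod_b1 (H : set (autT 'F_p)) : is_subgroup H ->
  (forall i, (1 < i <= r)%N -> H (b i)) -> exists2 h, H h & beta = b 1 ^+ (- f`_0)%R * h.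
Proof.
move=> sH Hb; rewrite beta_prod -(prednK r_gt0) big_ord_recl /=.
eexists; last by [].
apply: (big_ind H) => [|x y|j _]; [exact: (subgroup1 sH)|exact: (subgroupM sH)|].
by apply: (subgroupX _ sH); apply: Hb; have := ltn_ord j; rewrite /= /bump /=; lia.
Qed.

Lemma coprime_f0 : coprime (- f`_0)%R p.
Proof.
rewrite coprime_sym prime_coprime //.
have : ((- f`_0)%R : 'F_p) != 0%R by rewrite oppr_eq0.
by rewrite -[X in X != _]natr_Zp (dvdn_pcharf (pchar_Fp pp)).
Qed.

(** The exponent of [b 1] in [beta] is prime to [p], the constant coefficient of [f] being nonzero.
    So [beta], a section of [b r], supplies [b 1], while the other [b i] are sections of their
    predecessors. *)
Lemma b1_of_beta (H : set (autT 'F_p)) : is_subgroup H ->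
  (forall i, (1 < i <= r)%N -> H (b i)) -> H beta -> H (b 1).
Proof.
move=> sH Hb; have [h Hh ->] := beta_mod_b1 sH Hb => Hbeta.
apply: (subgroup_expg_inj sH coprime_f0); first exact: subgroup_divr Hbeta.
by rewrite directed_expp; [exact: (subgroup1 sH)|exact: directed_mem_b].
Qed.

(** All [b i] go together: depth [n.+1] for [b r] uses [beta], hence depth [n] for every directed
    generator. *)
Lemma beta_shift_ind (P : nat -> set (autT 'F_p)) : (forall n, is_subgroup (P n)) ->
    (forall n, P n a) -> (forall i, (0 < i <= r)%N -> P 0 (b i)) ->
    (forall n x, level_stab 1 x -> (forall z, P n (section [:: z] x)) -> P n.+1 x) ->
  forall n i, (0 < i <= r)%N -> P n (b i).
Proof.
move=> sP Pa P0 PS; elim=> [|n IH] i ir; first exact: P0.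
apply: PS; first exact: b_stab.
move=> z; have P1 := subgroup1 (sP n).
have [ir'|ri] := ltnP i r.
  rewrite section_b; last by lia.
  by case: ifP => // _; apply: IH; lia.
have -> : i = r by lia.
rewrite section_br; case: ifP => [_|_]; first exact: Pa.
case: ifP => // _; suff : B `<=` P n by apply; apply: directed_mem_beta.
by apply: gen_by_min => // _ [j jr <-]; apply: IH.
Qed.

Lemma sunic_shifting : G `<=` @shifting p.
Proof.
have lab_cons g z v : lab g (z :: v) = lab (section [:: z] g) v by rewrite lab_section.
have aS : shifting a.
  move=> [|z v] x; first by rewrite act_a act_root /lab act_a /= addr0 addrC.
  by rewrite !act_a lab_cons section_a lab1 addr0.
apply: gen_by_min; first exact: shifting_subgroup.
move=> _ [->//|[i /= ir <-]] v x.
suff : shifting_upto (size v) (b i) by apply.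
apply: (beta_shift_ind (P := @shifting_upto p)) => //.
- exact: shifting_upto_subgroup.
- by move=> n w y _; apply: aS.
- move=> j jr [|//] y _; rewrite act_root /=.
  by rewrite /lab !(b_stab jr) //= addr0.
- move=> n g gS IH [|z w] y wn; first by rewrite act_root /lab !gS //= addr0.
  rewrite lab_cons -[z :: w]/([:: z] ++ w) -[rcons (z :: w) y]/([:: z] ++ rcons w y).
  by rewrite !sectionE IH // rcons_cat.
Qed.

Lemma sunic_section u g : G g -> G (section u g).
Proof.
have sG := sunic_subgroup; have G1 := subgroup1 sG.
suff h1 : G `<=` [set g | G g /\ forall z, G (section [:: z] g)].
  elim: u g => [|z u IH] g Gg; first by rewrite section_nil.
  by rewrite -[z :: u]/([:: z] ++ u) section_cat; apply: IH; apply: (h1 g Gg).2.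
apply: gen_by_min.
  split=> [|x y [Gx x1] [Gy y1]]; first by split=> // z; rewrite section1.
  split=> [|z]; first exact: sG.2.
  rewrite sectionM -[X in section X (y^-1)](Defs.actKV y) sectionV; apply: sG.2 => //.
  have : size (y^-1 (x [:: z])) = 1%N by rewrite !size_act.
  by case: (y^-1 _) => [//|t []].
move=> _ [->|[i /= ir <-]]; first by split=> [|z]; [exact: sunic_mem_a|rewrite section_a].
split=> [|z]; first exact: sunic_mem_b.
have [ir'|ri] := ltnP i r.
  rewrite section_b; last by lia.
  by case: ifP => // _; apply: sunic_mem_b; lia.
have -> : i = r by lia.
rewrite section_br; case: ifP => [_|_]; first exact: sunic_mem_a.
by case: ifP => // _; apply: directed_sub; apply: directed_mem_beta.
Qed.

Lemma lab_a : lab a [::] = 1%R.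
Proof. by rewrite /lab -[rcons _ _]/[:: 0%R] act_a addr0. Qed.

Lemma lab_sum_a k : lab_sum k.+1 a = 0%R.
Proof. by rewrite lab_sum_section big1 // => z _; rewrite section_a lab_sum1. Qed.

(** If all totals vanished one level further down, those of [b 2, ..., b r] and [beta], being totals
    of sections, would vanish on the present level, and by [b1_of_beta] that of [b 1] too. *)
Lemma lab_sum_b k : exists2 i, (0 < i <= r)%N & lab_sum k.+1 (b i) != 0%R.
Proof.
have rr : (0 < r <= r)%N by rewrite r_gt0 /=.
have n10 : (1 == 0 :> 'F_p)%R = false by rewrite oner_eq0.
have n01 : (0 == 1 :> 'F_p)%R = false by rewrite eq_sym n10.
have sum_br m : lab_sum m.+1 (b r) = (lab_sum m a + lab_sum m beta)%R.
  rewrite lab_sum_section (bigD1 1%R) //= (bigD1 0%R) ?n01 //=.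
  rewrite !section_br !eqxx n01 big1 ?addr0 // => z /andP[/negbTE z1 /negbTE z0].
  by rewrite section_br z1 z0 lab_sum1.
elim: k => [|k [i ir iN]].
  (* On level one the section [a] of [b r] contributes [1], and [beta], fixing level one,
     contributes [0]. *)
  exists r => //; rewrite sum_br.
  have [betaS _ _ _] := directed_sections directed_mem_beta.
  rewrite -[lab_sum 0 a]/(lab a [::]) lab_a -[lab_sum 0 beta]/(lab beta [::]).
  by rewrite /lab betaS // last_rcons addr0 oner_neq0.
apply: contrapT => all0.
have b0 j : (0 < j <= r)%N -> lab_sum k.+2 (b j) = 0%R.
  by move=> jr; apply: contrapT => /eqP jN; apply: all0; exists j.
have bS j : (0 < j <= r)%N -> shifting (b j) by move=> /sunic_mem_b/sunic_shifting.
have Hb j : (1 < j <= r)%N -> lab_sum k.+1 (b j) = 0%R.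
  move=> jr; have jr1 : (0 < j.-1 < r)%N by lia.
  have := b0 j.-1; rewrite lab_sum_section (bigD1 0%R) //= big1 => [|z /negbTE z0].
    by rewrite addr0 section_b // eqxx prednK; [apply; lia|lia].
  by rewrite section_b // z0 lab_sum1.
have Hbeta : lab_sum k.+1 beta = 0%R by have := b0 r rr; rewrite sum_br lab_sum_a add0r.
have sK := @lab_sum_ker p k.+1.
have [_ H1] : shifting (b 1) /\ lab_sum k.+1 (b 1) = 0%R.
  apply: (b1_of_beta sK) => [j jr|].
    by split; [apply: bS; lia|exact: Hb].
  by split=> //; apply: sunic_shifting; apply: directed_sub; apply: directed_mem_beta.
case/negP: iN; apply/eqP.
by have [->|i1] := eqVneq i 1%N; [exact: H1|apply: Hb; lia].
Qed.

Lemma sunic_lab_sum k : exists2 g, G g & lab_sum k g != 0%R.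
Proof.
case: k => [|k]; last first.
  by have [i ir iN] := lab_sum_b k; exists (b i) => //; apply: sunic_mem_b.
exists a; first exact: sunic_mem_a.
by rewrite -[lab_sum 0 a]/(lab a [::]) lab_a oner_neq0.
Qed.

Lemma aX_transitive z z' : exists i, (a ^+ i) [:: z] = [:: z'].
Proof. by exists (z' - z)%R; rewrite act_aX natr_Zp subrK. Qed.

(** Conjugation by powers of [a] makes the group of sections independent of the letter. So [a] may
    be taken from [b r] at [1], and [beta], [b 2, ..., b r] at [0]. *)
Lemma fractal_letter z g : G g -> exists h, [/\ G h, h [:: z] = [:: z] & section [:: z] h = g].
Proof.
have sG := sunic_subgroup.
pose F t : set (autT 'F_p) := [set g | exists h, [/\ G h, h [:: t] = [:: t] & section [:: t] h = g]].
have sF t : is_subgroup (F t).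
  split; first by exists 1; split; [exact: (subgroup1 sG)| |rewrite section1].
  move=> _ _ [x [Gx xt <-]] [y [Gy yt <-]]; exists (x * y^-1); split.
  - exact: sG.2.
  - by rewrite Defs.actM xt stabV.
  - by rewrite sectionM xt sectionV_fix.
have FJ t t' : F t `<=` F t'.
  move=> _ [h [Gh ht <-]]; have [i it] := aX_transitive t t'.
  have Gi : G (a ^+ i) by apply: (subgroupX _ sG); apply: sunic_mem_a.
  exists (h ^ (a ^+ i)); split; first exact: (subgroupJ sG).
    by rewrite -it -Defs.actM -conjgC Defs.actM ht.
  by rewrite -it sectionJ // section_aX conjg1.
suff : G `<=` F z by apply.
have n01 : (0 == 1 :> 'F_p)%R = false by rewrite eq_sym oner_eq0.
have rr : (0 < r <= r)%N by rewrite r_gt0 /=.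
have Fa : F z a.
  apply: (FJ 1%R); exists (b r); split; [exact: sunic_mem_b|exact: b_stab|].
  by rewrite section_br eqxx.
have Fbeta : F z beta.
  by apply: (FJ 0%R); exists (b r); split; [exact: sunic_mem_b|exact: b_stab|].
have Fb i : (1 < i <= r)%N -> F z (b i).
  move=> ir; apply: (FJ 0%R); exists (b i.-1); split.
  - by apply: sunic_mem_b; lia.
  - by apply: b_stab => //; lia.
  - by rewrite section_b ?eqxx ?prednK //; lia.
apply: gen_by_min => // _ [->//|[i /= ir <-]].
by have [->|i1] := eqVneq i 1%N; [exact: (b1_of_beta (sF z))|apply: Fb; lia].
Qed.

Lemma fractal u g : G g -> exists h, [/\ G h, h u = u & section u h = g].
Proof.
elim: u g => [|z u IH] g Gg; first by exists g; rewrite act_root section_nil.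
have [h [Gh hu <-]] := IH g Gg; have [k [Gk kz kh]] := fractal_letter z Gh.
exists k; split=> //; last by rewrite -[z :: u]/([:: z] ++ u) section_cat kh.
by rewrite -[z :: u]/([:: z] ++ u) sectionE kz kh hu.
Qed.

End SunicGroup.

(** * Branching and commutators of a normal subgroup *)

Lemma mulg_p2 (gT : groupType) (x : gT) p : p = 2%N -> x ^+ p = 1 -> x * x = 1.
Proof. by move=> ->; rewrite expg2. Qed.

Lemma F2_val p (v : 'F_p) : prime p -> p = 2%N -> v != 0%R -> v = 1%N :> nat.
Proof.
move=> pp p2 v0; have vp : (v < p)%N := leq_trans (ltn_ord v) (eq_leq (Fp_cast pp)).
have : (v : nat) != 0%N by apply: contraNneq v0 => e; apply/eqP/val_inj.
by have := leq_trans vp (eq_leq p2); lia.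
Qed.

Lemma F2_add1 p (v : 'F_p) : prime p -> p = 2%N -> v != 0%R -> (1 + v = 0)%R.
Proof.
move=> pp p2 v0; rewrite -[v]natr_Zp (F2_val pp p2 v0).
exact: etrans (congr1 (fun m => m%:R)%R (esym p2)) (pchar_Fp_0 pp).
Qed.

Section Branching.
Variables (p r : nat) (f : {poly 'F_p}) (b : nat -> autT 'F_p).
Hypothesis pp : prime p.
Hypothesis r_gt0 : (0 < r)%N.
Hypothesis f0 : (f`_0 != 0)%R.
Hypothesis bP : directed_system r f b.
Implicit Types (g h x y k : autT 'F_p) (u v w : seq 'F_p) (z : 'F_p).
Implicit Types D : set (autT 'F_p).

Local Notation a := (sunic_a p).
Local Notation G := (sunic_group r b).
Local Notation B := (directed_group r b).
Local Notation beta := (directed_last r b).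

Hypothesis Gtrans : level_transitive G.

Let sG : is_subgroup G := sunic_subgroup r b.

Lemma level_stab1_ext x y : level_stab 1 x -> level_stab 1 y ->
  (forall z, section [:: z] x = section [:: z] y) -> x = y.
Proof.
move=> xS yS e; rewrite [x]level_stab1_prod // [y]level_stab1_prod //.
by apply: eq_bigr => z _; rewrite e.
Qed.

Definition section_preim D w : set (autT 'F_p) := [set x | G x /\ D (at_word w x)].

(** By [fractal], conjugation by [g] on the copies at [w] is induced by an element of [G] fixing
    [w]. *)
Lemma section_preim_normal D w : normal_in G D -> normal_in G (section_preim D w).
Proof.
move=> [sD DG nD]; split.
- split=> [|x y [Gx Dx] [Gy Dy]].
    by split; [exact: (subgroup1 sG)|rewrite at_word1; exact: (subgroup1 sD)].
  by split; [exact: sG.2|rewrite at_wordM at_wordV; exact: sD.2].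
- by move=> x [].
- move=> g x Gg [Gx Dx]; split; first exact: (subgroupJ sG).
  have [h [Gh hw <-]] := fractal pp r_gt0 f0 bP w Gg.
  by rewrite -{1}hw -at_wordJ; apply: nD.
Qed.

Lemma section_preim_sub D v w : normal_in G D -> size v = size w ->
  section_preim D v `<=` section_preim D w.
Proof.
move=> nD vw x [Gx Dx]; have [h Gh hv] := Gtrans vw.
have [_ _ nDG] := nD.
have Gs : G (section v h) by apply: (sunic_section pp r_gt0 f0 bP).
have [_ _ nP] := section_preim_normal w nD.
rewrite -[x](conjgK (section v h)); apply: nP; first exact: (subgroupV sG).
split; first exact: (subgroupJ sG).
by rewrite -hv -at_wordJ; apply: nDG.
Qed.

(** The branching subgroup is [comm_closure 1], that is [sunic_K], for [p = 2]; for odd [p] it is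
    [comm_closure 0], the derived subgroup, as the [b i] commute. *)
Definition comm_closure i0 := normal_closure G
  [set [~ a, b i] | i in [set i | (i0 < i <= r)%N]].

Lemma comm_closure_normal i0 : normal_in G (comm_closure i0).
Proof.
apply: (normal_closure_normal sG) => _ [i /= ir <-].
apply: (subgroupR sG); [exact: sunic_mem_a|apply: sunic_mem_b].
by case/andP: ir => /(leq_ltn_trans (leq0n _)) -> ->.
Qed.

Lemma comm_closure_mem i0 i : (i0 < i <= r)%N -> comm_closure i0 [~ a, b i].
Proof. by move=> ir; apply: sub_normal_closure; exists i. Qed.

Lemma section_Ja x z : level_stab 1 x -> section [:: (1 + z)%R] (x ^ a) = section [:: z] x.
Proof.
by move=> xS; rewrite -act_a sectionJ ?section_a ?conjg1 //; apply: xS.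
Qed.

(* [[a, b_r]] has sections [beta^-1 a] at [1] and [a^-1] (times [beta] if
   [p = 2]) at [2], while [b_j ^ a] has sections [b_j] at [0], [1] moved to
   [1], [2]. *)
Lemma comm_br_bj j : (0 < j <= r)%N -> (j < r)%N || odd p ->
  [~ [~ a, b r], b j ^ a] = at_word [:: 1%R] [~ a, section [:: 0%R] (b j)].
Proof.
move=> jr jp; have rr : (0 < r <= r)%N by rewrite r_gt0 /=.
have n10 : (1 == 0 :> 'F_p)%R = false by rewrite oner_eq0.
have brS := b_stab bP rr; have bjS := b_stab bP jr.
have sS := level_stab_subgroup 'F_p 1.
have bjaS := level_stabJ a bjS.
have cE : [~ a, b r] = (b r)^-1 ^ a * b r by rewrite commgEr.
have cS : level_stab 1 [~ a, b r].
  by rewrite cE; apply: (subgroupM sS) => //; apply: level_stabJ; apply: (subgroupV sS).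
have csec z : section [:: (1 + z)%R] [~ a, b r] =
    (section [:: z] (b r))^-1 * section [:: (1 + z)%R] (b r).
  rewrite cE sectionM; congr (_ * section _ _).
    by rewrite section_Ja; [apply: sectionV_fix; apply: brS|apply: (subgroupV sS)].
  by apply: (level_stabJ a (subgroupV sS brS)).
apply: level_stab1_ext; first exact: (subgroupR sS).
  exact: (@at_word_stab _ [:: 1%R : 'F_p]).
move=> z; rewrite -[z](subrKC 1%R); move: (z - 1)%R => {}z.
rewrite sectionR; [|exact: cS|exact: bjaS].
rewrite section_Ja // csec section_at_word // eqseq_cons eqxx andbT.
rewrite -[X in _ == X]addr0 (inj_eq (addrI _)).
have [->|z0] := eqVneq z 0%R.
  have Bx : B (section [:: 0%R] (b j)).
    by have [_ _] := directed_sections pp r_gt0 f0 bP (directed_mem_b jr).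
  rewrite addr0 !(section_br bP) eqxx -/beta eq_sym n10.
  have -> : [~ beta^-1 * a, section [:: 0%R] (b j)] =
    [~ beta^-1, section [:: 0%R] (b j)] ^ a * [~ a, section [:: 0%R] (b j)].
    by rewrite /commg /conjg !gnorm.
  rewrite (directed_commute pp r_gt0 f0 bP (x := beta^-1)) ?conj1g ?mul1g //.
  exact: (subgroupV (directed_subgroup r b) (directed_mem_beta bP)).
have [z1|z1] := eqVneq z 1%R; last first.
  have [_ _ _ ->] := directed_sections pp r_gt0 f0 bP (directed_mem_b jr) => //.
  by rewrite commg1.
(* At the letter [2]: for [j < r] the second section is trivial; for [j = r] the prime is odd, so
   [2] is neither [0] nor [1], and both sections are powers of [a]. *)
have [jr'|rj] := ltnP j r.
  by rewrite (section_b bP (i := j)) ?(negbTE z0) ?commg1 //; lia.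
have ej : j = r by lia.
rewrite ej !(section_br bP) z1 eqxx.
have -> : (1 + 1 == 1 :> 'F_p)%R = false.
  by rewrite -[X in _ == X]addr0 (inj_eq (addrI _)).
have -> : (1 + 1 == 0 :> 'F_p)%R = false.
  apply/negbTE; rewrite -[(1 + 1)%R]/(2%:R)%R -(dvdn_pcharf (pchar_Fp pp)).
  move: jp; rewrite ej ltnn /= => op.
  by rewrite dvdn_prime2 //; apply/eqP => p2; move: op; rewrite p2.
by rewrite mulg1; apply/eqP/commgP; apply/commute_sym/commuteV.
Qed.

(** For [r > 1], [b 1] acts only below the letter [0], and its conjugate by [a] only below [1]. *)
Lemma commg_b1a_b1 : (1 < r)%N -> [~ b 1 ^ a, b 1] = 1.
Proof.
move=> r1; have r11 : (0 < 1 < r)%N by rewrite r1.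
have b1S : level_stab 1 (b 1) by apply: (b_stab bP); lia.
have b1aS := level_stabJ a b1S; have sS := level_stab_subgroup 'F_p 1.
apply: level_stab1_ext; [exact: (subgroupR sS)|exact: (subgroup1 sS)|move=> z].
rewrite section1 -[z](subrKC 1%R); move: (z - 1)%R => {}z.
rewrite sectionR; [|exact: b1aS|exact: b1S].
rewrite section_Ja // !(section_b bP) //; have [->|_] := eqVneq z 0%R; last by rewrite comm1g.
by rewrite addr0 oner_eq0 commg1.
Qed.

Variable i0 : nat.
Hypothesis i0P : (odd p /\ i0 = 0%N) \/ [/\ p = 2%N, i0 = 1%N & (1 < r)%N].

Local Notation K := (comm_closure i0).

Lemma i0_lt_r : (i0 < r)%N.
Proof. by case: i0P => [[_ ->]|[_ -> ]]. Qed.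

(** Only normal generators at the letter [1] matter. There [comm_br_bj] gives [[~ a, t]] for [t] a
    section at [0] of some [b j]: these are [b 2, ..., b r] and, for odd [p], also [beta], hence
    [b 1]. *)
Lemma comm_closure_branch z k : K k -> commg_group K G (at_word [:: z] k).
Proof.
move=> Kk; have nK := comm_closure_normal i0; have nE := commg_group_normal sG nK.
have ir := i0_lt_r.
suff h : K `<=` section_preim (commg_group K G) [:: 1%R].
  by case: (section_preim_sub (w := [:: z]) nE _ (h _ Kk)).
have nP := section_preim_normal [:: 1%R] nE.
have sQ := commg_stab_subgroup a sG nP.
have [sB bG] := (directed_subgroup r b, @directed_sub p r b).
have Qsec j : (0 < j <= r)%N -> (j < r)%N || odd p ->
    [set t | G t /\ section_preim (commg_group K G) [:: 1%R] [~ a, t]] (section [:: 0%R] (b j)).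
  move=> jr jp; have Gj : G (section [:: 0%R] (b j)).
    by apply: (sunic_section pp r_gt0 f0 bP); apply: sunic_mem_b.
  split=> //; split; first by apply: (subgroupR sG) => //; exact: sunic_mem_a.
  rewrite -comm_br_bj //; apply: commg_groupP.
    by apply: comm_closure_mem; lia.
  by apply: (subgroupJ sG); [exact: sunic_mem_b|exact: sunic_mem_a].
have Qb i : (1 < i <= r)%N ->
    [set t | G t /\ section_preim (commg_group K G) [:: 1%R] [~ a, t]] (b i).
  move=> ir'; have := Qsec i.-1; rewrite (section_b bP) ?eqxx ?prednK; try lia.
  by apply; lia.
apply: normal_closure_min => // _ [i /= ii <-].
have [i1|i1] := eqVneq i 1%N; last by case: (Qb i) => //; lia.
case: i0P => [[op _]|[_ i01 _]]; last by lia.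
rewrite i1; case: (b1_of_beta pp r_gt0 f0 bP sQ Qb) => //.
by apply: Qsec; rewrite ?op ?orbT //; lia.
Qed.

Lemma comm_closure_at w k : K k -> K (at_word w k).
Proof.
have CK := commg_group_sub (comm_closure_normal i0).
elim: w k => [//|z w IH] k Kk; rewrite -[z :: w]/([:: z] ++ w) at_word_cat.
by apply: CK; apply: comm_closure_branch; apply: IH.
Qed.

(** * Commutators of a normal subgroup with copies of the branching subgroup *)

Section Key.
Variables (N : set (autT 'F_p)) (n : nat).
Hypothesis nN : normal_in G N.
Hypothesis NS : N `<=` @level_stab _ n.

Local Notation D := (commg_group N G).

Let nD : normal_in G D := commg_group_normal sG nN.
Let nK : normal_in G K := comm_closure_normal i0.

(** By [section_preim_sub] the group [Z] is the same for all vertices of level [n.+1]. *)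
Variable w0 : seq 'F_p.
Hypothesis w0n : size w0 = n.+1.

Local Notation Z := (section_preim D w0).

Let nZ : normal_in G Z := section_preim_normal w0 nD.

(* Conjugating [[~ g, at_word w k]], whose sections at [w] and [g w] are
   conjugates of [k] and [k^-1], by elements [h] fixing both vertices produces
   elements of [centr_mod] out of the sections of [h]. *)
Definition centr_mod := [set t | G t /\ forall k, K k -> Z [~ k, t]].
Local Notation T := centr_mod.

Lemma centr_mod_normal : normal_in G T.
Proof. exact: commg_stab_normal. Qed.

Lemma centr_mod_sections g h w : N g -> G h -> size w = n.+1 -> h w = w -> h (g w) = g w ->
  T (section w h ^ section w g * (section (g w) h)^-1).
Proof.
move=> Ng Gh wn hw hgw; have [_ NG _] := nN; have Gg := NG _ Ng.
have [sD _ nDG] := nD; have [_ KG nKG] := nK.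
have GS u x : G x -> G (section u x) by apply: (sunic_section pp r_gt0 f0 bP).
set y := section w g; set t := section w h; set t' := section (g w) h.
have [Gy Gt Gt'] : [/\ G y, G t & G t'] by split; apply: GS.
have GyV := subgroupV sG Gy; have GtV' := subgroupV sG Gt'.
split; first by apply: (subgroupM sG) => //; apply: (subgroupJ sG).
(* [q k] is the commutator of [g] with the copy of [k] at [w]; the [k] chosen below makes its entry
   at [g w] equal to [l^-1]. *)
move=> l Kl; pose q k := at_word (g w) (k^-1 ^ y) * at_word w k.
have Dq k : K k -> D (q k).
  move=> Kk; rewrite /q -at_wordJ at_wordV -commgEr; apply: commg_groupP => //.
  by apply: KG; apply: comm_closure_at.
pose k := l ^ y^-1.
have Kk : K k by apply: nKG.
(* Both commutators have the entry [k ^ t] at [w], which cancels, so a copy at [g w] remains. *)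
have Dk : D (q k ^ h * (q (k ^ t))^-1).
  by apply: sD.2; [apply: nDG => //; apply: Dq|apply: Dq; apply: nKG].
have Pk : section_preim D (g w) ([~ l, t ^ y * t'^-1] ^ t').
  split.
    apply: (subgroupJ sG) => //; apply: (subgroupR sG); first exact: KG.
    by apply: (subgroupM sG) => //; apply: (subgroupJ sG).
  move: Dk; rewrite /q conjMg !at_wordJ hw hgw -/t -/t'.
  rewrite (invgM (at_word (g w) _)) -mulgA (mulgA (at_word w _)) mulgV mul1g.
  rewrite -at_wordV -at_wordM; congr (D (at_word _ _)).
  by rewrite /k /commg /conjg !gnorm.
have [_ _ nP] := section_preim_normal (g w) nD.
apply: (section_preim_sub nD _ (v := g w)); first by rewrite size_act wn w0n.
by rewrite -[X in section_preim _ _ X](conjgK t'); apply: nP.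
Qed.

(** By [fractal], some [h] has section [s] at [u], and [g] moves the letter below [u] by
    [lab g u]. *)
Lemma centr_mod_letter g u s z : N g -> size u = n -> G s -> level_stab 1 s ->
  exists2 y, G y &
    T (section [:: z] s ^ y * (section [:: (z + lab g u)%R] s)^-1).
Proof.
move=> Ng un Gs sS; have [_ NG _] := nN; have Gg := NG _ Ng.
have [h [Gh hu hs]] := fractal pp r_gt0 f0 bP u Gs.
have gS := sunic_shifting pp r_gt0 f0 bP Gg.
have fix_rcons t : h (rcons u t) = rcons u t.
  by rewrite -cats1 sectionE hu hs sS.
have gw : g (rcons u z) = rcons u (z + lab g u)%R by rewrite gS (NS Ng).
exists (section (rcons u z) g); first exact: (sunic_section pp r_gt0 f0 bP).
have := centr_mod_sections (w := rcons u z) Ng Gh.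
by rewrite gw !fix_rcons -!cats1 !section_cat hs size_cat un addn1; apply.
Qed.

Lemma centr_mod_letter1 g u s z : N g -> size u = n -> G s -> level_stab 1 s ->
  section [:: (z + lab g u)%R] s = 1 -> T (section [:: z] s).
Proof.
move=> Ng un Gs sS e; have [_ _ nT] := centr_mod_normal.
have [y Gy] := centr_mod_letter z Ng un Gs sS.
rewrite e invg1 mulg1 => Ty; rewrite -[section _ _](conjgK y).
by apply: nT => //; apply: (subgroupV sG).
Qed.

Lemma centr_mod_b g u i : N g -> size u = n -> lab g u != 0%R ->
  (1 < i <= r)%N -> T (b i).
Proof.
move=> Ng un /negbTE gu ir; have ir' : (0 < i.-1 < r)%N by lia.
have := @centr_mod_letter1 g u (b i.-1) 0%R Ng un.
rewrite !(section_b bP) // eqxx add0r gu prednK; last by lia.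
by apply=> //; [apply: sunic_mem_b|apply: (b_stab bP)]; lia.
Qed.

(** The only nontrivial sections of [b r] are at [0] and [1]. The letter [1] is moved off this pair
    unless the label is [-1], the letter [0] unless it is [1]. In the exceptional cases [g^-1]
    serves, as [1] and [-1] differ. *)
Lemma centr_mod_odd g u : odd p -> N g -> size u = n -> lab g u != 0%R -> G `<=` T.
Proof.
move=> op Ng un gu; have [sT TG nT] := centr_mod_normal; have [sN NG _] := nN.
have rr : (0 < r <= r)%N by rewrite r_gt0 /=.
have n01 : (0 == 1 :> 'F_p)%R = false by rewrite eq_sym oner_eq0.
have brS := b_stab bP rr; have Gbr := sunic_mem_b (b := b) rr.
have n11 : (1 != -1 :> 'F_p)%R.
  rewrite -addr_eq0 -[(1 + 1)%R]/(2%:R)%R -(dvdn_pcharf (pchar_Fp pp)).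
  by rewrite dvdn_prime2 //; apply/eqP => p2; move: op; rewrite p2.
have Ta x : N x -> lab x u != 0%R -> lab x u != (-1)%R -> T a.
  move=> Nx x0 x1; have := @centr_mod_letter1 x u (b r) 1%R Nx un Gbr brS.
  rewrite !(section_br bP) eqxx -[X in _ == X]addr0 (inj_eq (addrI _)) (negbTE x0).
  by rewrite addrC addr_eq0 (negbTE x1); apply.
have Tbeta x : N x -> lab x u != 0%R -> lab x u != 1%R -> T beta.
  move=> Nx x0 x1; have := @centr_mod_letter1 x u (b r) 0%R Nx un Gbr brS.
  by rewrite !(section_br bP) add0r n01 eqxx (negbTE x0) (negbTE x1) -/beta; apply.
have gV : lab g^-1 u = (- lab g u)%R.
  have gS := sunic_shifting pp r_gt0 f0 bP (NG _ Ng).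
  have := labM u gS (subgroupV (@shifting_subgroup p) gS).
  by rewrite mulgV lab1 (NS Ng) // => /esym/eqP; rewrite addrC addr_eq0 => /eqP.
have NgV := subgroupV sN Ng; have gVN : lab g^-1 u != 0%R by rewrite gV oppr_eq0.
have Ta' : T a.
  have [g1|g1] := eqVneq (lab g u) (-1)%R; last exact: (Ta g).
  by apply: (Ta g^-1) => //; rewrite gV g1 opprK.
have Tbeta' : T beta.
  have [g1|g1] := eqVneq (lab g u) 1%R; last exact: (Tbeta g).
  by apply: (Tbeta g^-1) => //; rewrite gV g1 eq_sym.
have Tb i : (1 < i <= r)%N -> T (b i) by apply: centr_mod_b un gu.
apply: gen_by_min => // _ [->//|[i /= ir <-]].
have [->|i1] := eqVneq i 1%N; first exact: (b1_of_beta pp r_gt0 f0 bP sT).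
by apply: Tb; lia.
Qed.

(* [(a b_1)^4 = 1] makes [a] and [b_1] generate a dihedral group of order at most
   [8] modulo [T]; there [b_1] is congruent to a conjugate of [a], hence to [a]. *)
Lemma centr_mod_even g u : p = 2%N -> (1 < r)%N -> N g -> size u = n -> lab g u != 0%R ->
  T (a^-1 * b 1).
Proof.
move=> p2 r1 Ng un gu; have nT := centr_mod_normal; have [sT TG nTG] := nT.
have rr : (0 < r <= r)%N by rewrite r_gt0 /=.
have Ga : G a by exact: sunic_mem_a.
have Gb i : (0 < i <= r)%N -> G (b i) := @sunic_mem_b p r b i.
have Gb1 : G (b 1) by apply: Gb; lia.
have Tb i : (1 < i <= r)%N -> T (b i) by apply: centr_mod_b un gu.
have aa : a * a = 1 := mulg_p2 p2 (a_expp pp).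
have bb i : (0 < i <= r)%N -> b i * b i = 1.
  by move=> ir; apply: (mulg_p2 p2); apply: (directed_expp pp r_gt0 f0 bP); apply: directed_mem_b.
have bb1 : b 1 * b 1 = 1 by apply: bb; lia.
have fixab : (a ^ b 1) ^ a = a ^ b 1.
  have aV : a^-1 = a := mulg1_eq aa.
  have b1V : (b 1)^-1 = b 1 := mulg1_eq bb1.
  have /commgP : [~ b 1 ^ a, b 1] == 1 by apply/eqP/commg_b1a_b1.
  rewrite /commute /conjg aV b1V => c; rewrite !mulgA in c *.
  by rewrite c -(mulgA _ a a) aa mulg1.
(* Two cosets of [T] that contain all conjugates of [a]. *)
pose A0 := [set t | T (a^-1 * t) \/ T ((a ^ b 1)^-1 * t)].
have sY : is_subgroup [set y | G y /\ forall t, A0 t <-> A0 (t ^ y)].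
  split=> [|x y [Gx Ax] [Gy Ay]].
    by split=> [|t]; [exact: (subgroup1 sG)|rewrite conjg1].
  split=> [|t]; first exact: sG.2.
  rewrite conjgM; have := Ay ((t ^ x) ^ y^-1); rewrite conjgKV => Ay'.
  by split=> [/(Ax t).1/Ay'.2|/Ay'.1/(Ax t).2].
have Yinv y : G y -> y * y = 1 -> (forall t, A0 t -> A0 (t ^ y)) ->
    [set y | G y /\ forall t, A0 t <-> A0 (t ^ y)] y.
  move=> Gy yy Ay; split=> // t; split; first exact: Ay.
  by move/Ay; rewrite -conjgM yy conjg1.
have A0y y : G y -> A0 (a ^ y).
  suff : G `<=` [set y | G y /\ forall t, A0 t <-> A0 (t ^ y)].
    move=> h /h[_ Ay]; apply: (Ay a).1; left; rewrite mulVg; exact: (subgroup1 sT).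
  apply: gen_by_min => // _ [->|[i /= ir <-]]; apply: Yinv => //; try exact: Gb; try exact: bb.
    move=> t [Tt|Tt]; [left|right].
      by have := nTG a _ Ga Tt; rewrite conjMg conjVg conjgE mulKg.
    by have := nTG a _ Ga Tt; rewrite conjMg conjVg fixab.
  have [->|i1] := eqVneq i 1%N.
    move=> t [Tt|Tt]; [right|left]; have := nTG _ _ Gb1 Tt; rewrite conjMg conjVg //.
    by rewrite -conjgM bb1 conjg1.
  have Ti : T (b i) by apply: Tb; lia.
  have Ai c t : G c -> T (c^-1 * t) -> T (c^-1 * t ^ b i).
    move=> Gc Tt; have -> : c^-1 * t ^ b i = [~ c, b i] * (c^-1 * t) ^ b i.
      by rewrite /commg /conjg !gnorm.
    apply: (subgroupM sT); first exact: normal_commgr nT _ _.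
    by apply: nTG => //; apply: Gb.
  move=> t [Tt|Tt]; [left|right]; apply: Ai => //.
  exact: (subgroupJ sG).
(* For [p = 2] the element [g] exchanges the two letters; the sections of [b r] there are [a] and
   [beta], and [beta] is congruent to [b 1] modulo [T]. *)
have [y Gy] := centr_mod_letter 1%R Ng un (Gb r rr) (b_stab bP rr).
rewrite !(section_br bP) eqxx (F2_add1 pp p2 gu) eq_sym oner_eq0 eqxx -/beta.
have [h Th ->] := beta_mod_b1 pp r_gt0 f0 bP sT Tb.
rewrite (F2_val pp p2) ?oppr_eq0 // expg1 => Ty.
have {}Ty : T ((a ^ y)^-1 * b 1).
  have := nTG (b 1 * h) _ (subgroupM sG Gb1 (TG _ Th)) (subgroupV sT Ty).
  have -> : (a ^ y * (b 1 * h)^-1)^-1 ^ (b 1 * h) = (a ^ y)^-1 * b 1 * h.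
    by rewrite /conjg !gnorm.
  exact: subgroup_divr.
have [Ta|Ta] := A0y y Gy; have := subgroupM sT Ta Ty; rewrite mulgA mulgK //.
have Gb1V := subgroupV sG Gb1.
by move=> /(nTG _ _ Gb1V); rewrite conjMg conjVg conjgK conjgE invgK !mulgA mulgK.
Qed.

(** For odd [p] all of [G] lies in [T]. For [p = 2] it suffices that each normal generator [c] of
    [K] is central modulo [Z]: [T] centralises it, so does [a], and [b 1] lies in the coset of
    [a]. *)
Lemma commg_closure_preim g u : N g -> size u = n -> lab g u != 0%R ->
  commg_group K G `<=` Z.
Proof.
move=> Ng un gu; have [sZ ZG _] := nZ.
suff KZ : forall k t, K k -> G t -> Z [~ k, t].
  by apply: gen_by_min => // _ [k [t [Kk Gt ->]]]; apply: KZ.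
case: i0P => [[op _]|[p2 i01 r1]].
  by move=> k t Kk Gt; have [_] := centr_mod_odd op Ng un gu Gt; apply.
have Tab := centr_mod_even p2 r1 Ng un gu.
have nC := commg_central_normal sG nZ nK.
suff: K `<=` [set k | K k /\ forall t, G t -> Z [~ k, t]].
  by move=> h k t Kk Gt; have [_] := h _ Kk; apply.
apply: normal_closure_min => // _ [i /= ir <-]; set c := [~ a, b i].
have Kc : K c by apply: comm_closure_mem.
split=> // t Gt; suff : G `<=` [set t | G t /\ Z [~ c, t]] by move=> h; case: (h t Gt).
have sS := commg_stab_subgroup c sG nZ.
have TS : T `<=` [set t | G t /\ Z [~ c, t]].
  by move=> x [Gx Tx]; split=> //; apply: Tx.
have Tb j : (1 < j <= r)%N -> T (b j) by apply: centr_mod_b un gu.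
have ir' : (1 < i <= r)%N by rewrite i01 in ir.
have Sa : [set t | G t /\ Z [~ c, t]] a.
  split; first exact: sunic_mem_a.
  have aa : a * a = 1 := mulg_p2 p2 (a_expp pp).
  have bb : b i * b i = 1.
    apply: (mulg_p2 p2); apply: (directed_expp pp r_gt0 f0 bP).
    by apply: directed_mem_b; lia.
  (* The involutions [a] and [b i] both invert their commutator [c]. *)
  have -> : [~ c, a] = [~ c, b i].
    have aV : a^-1 = a := mulg1_eq aa.
    have bV : (b i)^-1 = b i := mulg1_eq bb.
    have aK t' : a * (a * t') = t' by rewrite mulgA aa mul1g.
    have bK t' : b i * (b i * t') = t' by rewrite mulgA bb mul1g.
    by rewrite /c /commg /conjg !invgM !aV !bV -!mulgA !(aK, bK) ?bb ?mulg1.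
  by have [_] := TS _ (Tb _ ir').
have Sb1 : [set t | G t /\ Z [~ c, t]] (b 1).
  by rewrite -[b 1](mulVKg a); apply: (subgroupM sS Sa); apply: TS.
apply: gen_by_min => // _ [->//|[j /= jr <-]].
by have [->//|j1] := eqVneq j 1%N; apply: TS; apply: Tb; lia.
Qed.

End Key.

Theorem sections_in_commg N n : normal_in G N -> N `<=` @level_stab _ n ->
    ~ N `<=` @level_stab _ n.+1 ->
  forall x, level_stab n.+2 x -> (forall w, size w = n.+2 -> K (section w x)) ->
  commg_group N G x.
Proof.
move=> nN NS NNS x xS xK; have [sN NG nNG] := nN.
have [g [u [Ng un gu]]] : exists g u, [/\ N g, size u = n & lab g u != 0%R].
  apply: contrapT => all0; apply: NNS => g Ng.
  have gS := sunic_shifting pp r_gt0 f0 bP (NG _ Ng).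
  apply: level_stab_lab => // [|u un]; first exact: NS.
  by apply: contrapT => /eqP gu; apply: all0; exists g, u.
have nD := commg_group_normal sG nN; have [sD _ _] := nD.
apply: (at_word_generate sD _ xS xK) => w k.
case/lastP: w => [//|w z]; rewrite size_rcons => -[wn] Kk.
(* Level [n.+2] is reached in two stages: the copy at the letter [z] lies in [commg_group K G],
   whose elements may be placed at [w]. *)
rewrite -cats1 at_word_cat.
by have [_] := commg_closure_preim nN NS wn Ng un gu (comm_closure_branch z Kk).
Qed.

End Branching.

(** * Generators and cosets of a normal subgroup *)

Section Chains.
Variables (p r : nat) (f : {poly 'F_p}) (b : nat -> autT 'F_p).
Hypothesis pp : prime p.
Hypothesis r_gt0 : (0 < r)%N.
Hypothesis f0 : (f`_0 != 0)%R.
Hypothesis bP : directed_system r f b.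

Local Notation a := (sunic_a p).
Local Notation G := (sunic_group r b).
Local Notation K := (comm_closure r b).

Hypothesis Gtrans : level_transitive G.

Let sG : is_subgroup G := sunic_subgroup r b.
Let Gshift := sunic_shifting pp r_gt0 f0 bP.
Let Glab := sunic_lab_sum pp r_gt0 f0 bP.
Let Gsec := sunic_section pp r_gt0 f0 bP.

Definition generators := a :: [seq b i.+1 | i <- iota 0 r].

Lemma commg_b i j : (0 < i <= r)%N -> (0 < j <= r)%N -> [~ b i, b j] = 1.
Proof.
by move=> ir jr; apply: (directed_commute pp r_gt0 f0 bP); apply: directed_mem_b.
Qed.

Lemma generators_central c : c \in generators ->
  [/\ G c, forall g, G g -> K 0 [~ c, g] & K 0 (c ^+ p)].
Proof.
have nK := @comm_closure_normal p r b 0; have [sK KG nKG] := nK.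
have K1 := subgroup1 sK.
rewrite in_cons => /predU1P[->|/mapP[j]].
  split; [exact: sunic_mem_a| |by rewrite a_expp].
  have sS := commg_stab_subgroup a sG nK.
  suff h : G `<=` [set t | G t /\ K 0 [~ a, t]] by move=> g /h[].
  apply: gen_by_min => // _ [->|[i /= ir <-]].
    by split; [exact: sunic_mem_a|rewrite commgg].
  by split; [exact: sunic_mem_b|apply: comm_closure_mem].
rewrite mem_iota => jr ->; have {}jr : (0 < j.+1 <= r)%N by lia.
split; [exact: sunic_mem_b| |]; last first.
  by rewrite (directed_expp pp r_gt0 f0 bP) //; apply: directed_mem_b.
have sS := commg_stab_subgroup (b j.+1) sG nK.
suff h : G `<=` [set t | G t /\ K 0 [~ b j.+1, t]] by move=> g /h[].
apply: gen_by_min => // _ [->|[i /= ir <-]].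
  split; first exact: sunic_mem_a.
  by rewrite -invgR; apply: (subgroupV sK); apply: comm_closure_mem.
by split; [exact: sunic_mem_b|rewrite commg_b].
Qed.

Lemma cyclic_exts_mem (cs : seq (autT 'F_p)) H c : normal_in G H ->
    (forall c, c \in cs -> [/\ G c, forall g, G g -> H [~ c, g] & H (c ^+ p)]) ->
  c \in cs -> cyclic_exts cs H c.
Proof.
move=> nH; elim: cs => [//|d cs IH] cP; rewrite in_cons.
have csP e : e \in cs -> [/\ G e, forall g, G g -> H [~ e, g] & H (e ^+ p)].
  by move=> es; apply: cP; rewrite in_cons es orbT.
have [[sE _ _] _] := cyclic_exts_normal pp sG nH csP.
move=> /predU1P[->|/(IH csP)]; first exact: (cyclic_ext_id d sE).
exact: (@sub_cyclic_ext _ (cyclic_exts cs H) d).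
Qed.

Lemma generators_exts : G `<=` cyclic_exts generators (K 0).
Proof.
have nK := @comm_closure_normal p r b 0.
have [[sE _ _] _] := cyclic_exts_normal pp sG nK generators_central.
apply: gen_by_min => // _ [->|[i /= ir <-]].
  by apply: (cyclic_exts_mem nK generators_central); rewrite mem_head.
apply: (cyclic_exts_mem nK generators_central).
rewrite in_cons; apply/orP; right; apply/mapP; exists i.-1; last by rewrite prednK //; lia.
by rewrite mem_iota; lia.
Qed.

(** As [b 1] commutes with its conjugate by [a], the commutator [d] squares to [1] and commutes with
    [a] and [b 1]. Modulo [K 1] both of these commute with the other [b i], hence so does [d]. *)
Lemma comm_closure01 : p = 2%N -> (1 < r)%N ->
  [/\ forall g, G g -> K 1 [~ [~ a, b 1], g], K 1 ([~ a, b 1] ^+ p)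
    & K 0 `<=` cyclic_ext (K 1) [~ a, b 1]].
Proof.
move=> p2 r1; have nK := @comm_closure_normal p r b 1; have [sK KG nKG] := nK.
have K1 := subgroup1 sK; have Ga : G a by exact: sunic_mem_a.
have Gb i : (0 < i <= r)%N -> G (b i) := @sunic_mem_b p r b i.
have rr1 : (0 < 1 <= r)%N by lia.
set d := [~ a, b 1]; have Gd : G d by apply: (subgroupR sG) => //; apply: Gb.
have aa : a * a = 1 := mulg_p2 p2 (a_expp pp).
have bb : b 1 * b 1 = 1.
  apply: (mulg_p2 p2); apply: (directed_expp pp r_gt0 f0 bP); exact: directed_mem_b.
have aV : a^-1 = a := mulg1_eq aa.
have bV : (b 1)^-1 = b 1 := mulg1_eq bb.
have aK t : a * (a * t) = t by rewrite mulgA aa mul1g.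
have bK t : b 1 * (b 1 * t) = t by rewrite mulgA bb mul1g.
have dE : d = a * (b 1 * (a * b 1)) by rewrite /d /commg /conjg aV bV.
have dV : d = b 1 * (a * (b 1 * a)).
  have /eqP/commgP := commg_b1a_b1 pp r_gt0 f0 bP r1.
  by rewrite dE /commute /conjg aV -!mulgA.
have dd : d * d = 1 by rewrite {1}dV dE -!mulgA !(aK, bK).
have dG : forall g, G g -> K 1 [~ d, g].
  have sS := commg_stab_subgroup d sG nK.
  suff h : G `<=` [set t | G t /\ K 1 [~ d, t]] by move=> g /h[].
  apply: gen_by_min => // _ [->|[i /= ir <-]].
    split=> //; rewrite (_ : [~ _, _] = 1) //; apply/eqP/commgP.
    by rewrite /commute {1}dV dE -!mulgA aa mulg1 aK.
  split; first exact: Gb.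
  have [->|i1] := eqVneq i 1%N.
    rewrite (_ : [~ _, _] = 1) //; apply/eqP/commgP.
    by rewrite /commute {1}dE dV -!mulgA bb mulg1 bK.
  have ir' : (1 < i <= r)%N by lia.
  have sSi := commg_stab_subgroup (b i) sG nK.
  rewrite -invgR; apply: (subgroupV sK).
  suff [_ //] : [set t | G t /\ K 1 [~ b i, t]] d.
  apply: (subgroupR sSi); split=> //.
  - by rewrite -invgR; apply: (subgroupV sK); apply: comm_closure_mem.
  - exact: Gb.
  - by rewrite commg_b.
have dp : K 1 (d ^+ p) by rewrite [X in natexp _ X]p2 expg2 dd.
split=> //.
have nE := cyclic_ext_normal sG nK Gd (prime_gt0 pp) dG dp.
apply: normal_closure_min => // _ [i /= ir <-].
have [->|i1] := eqVneq i 1%N; first exact: cyclic_ext_id.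
by apply: sub_cyclic_ext; apply: comm_closure_mem; lia.
Qed.

(* One layer for each of the levels [n] and [n + 1], then [r + 1] for [G / K 0]
   at level [n + 2] and, if [p = 2], one more for [K 0 / K 1]. *)
Definition width := if odd p then r.+3 else r.+4.
Definition branch_start := if odd p then 0%N else 1%N.

Hypothesis r_gt1 : p = 2%N -> (1 < r)%N.

Lemma branch_startP :
  (odd p /\ branch_start = 0%N) \/ [/\ p = 2%N, branch_start = 1%N & (1 < r)%N].
Proof.
rewrite /branch_start; case: (even_prime pp) => [p2|op]; last by left; rewrite op.
have np : odd p = false by apply: negbTE; rewrite p2.
by right; split=> //; [rewrite np|apply: r_gt1].
Qed.

Lemma sunic_layers N n : normal_in G N -> N `<=` @level_stab _ n ->
  exists2 N', layers G width N N' & forall x, N' x -> level_stab n.+2 x /\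
    forall w, size w = n.+2 -> K branch_start (section w x).
Proof.
move=> nN NS; have nK i0 := @comm_closure_normal p r b i0.
pose N1 := N `&` @level_stab 'F_p n.+1; pose N2 := N1 `&` @level_stab 'F_p n.+2.
have nN1 : normal_in G N1 by apply: level_stab_normal.
have nN2 : normal_in G N2 by apply: level_stab_normal.
have N1S : N1 `<=` @level_stab 'F_p n.+1 by move=> x [].
have N2S : N2 `<=` @level_stab 'F_p n.+2 by move=> x [].
have l1 : layer G N N1 by apply: (level_layer pp sG Gshift Glab Gsec nN NS).
have l2 : layer G N1 N2 by apply: (level_layer pp sG Gshift Glab Gsec nN1 N1S).
suff [N' l3 N'P] : exists2 N', layers G (width - 2) N2 N' & forall x, N' x ->
    level_stab n.+2 x /\ forall w, size w = n.+2 -> K branch_start (section w x).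
  exists N' => //; have -> : width = (width - 2).+2 by rewrite /width; case: odd.
  exists N1; split=> //; first by move=> x [].
  by exists N2; split=> //; move=> x [].
have ext0 x w : N2 x -> size w = n.+2 -> cyclic_exts generators (K 0) (section w x).
  by case: nN2 => _ N2G _ /N2G Gx _; apply: generators_exts; apply: Gsec.
have := cyclic_exts_layers pp sG Gshift Glab Gsec nN2 N2S (nK 0%N) generators_central ext0.
have -> : size generators = r.+1 by rewrite /= size_map size_iota.
pose N3 := sections_in N2 n.+2 (K 0).
have N3S : N3 `<=` @level_stab 'F_p n.+2 by move=> x [/N2S].
have nN3 : normal_in G N3 by apply: (sections_in_normal Gsec).
rewrite -/N3 => l3.
case: branch_startP => [[op ->]|[p2 -> r1]].
  exists N3; last by move=> x [/N2S xS xK].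
  by rewrite /width op subSS subSS subn0.
have [dG dp dK] := comm_closure01 p2 r1.
have l4 : layers G 1 N3 (sections_in N3 n.+2 (K 1)).
  have Gd : G [~ a, b 1].
    apply: (subgroupR sG); first exact: sunic_mem_a.
    by apply: sunic_mem_b; lia.
  apply: (@cyclic_exts_layers p pp G sG Gshift Glab Gsec [:: [~ a, b 1]]) => //.
  - by move=> c; rewrite inE => /eqP ->; split.
  - by move=> x w [_ xK] wn; apply: dK; apply: xK.
exists (sections_in N3 n.+2 (K 1)); last by move=> x [/N3S xS xK].
have -> : (width - 2 = r.+1 + 1)%N by rewrite /width p2 /=; lia.
exact: (layers_cat l3 l4).
Qed.

Lemma sunic_normal_level N : normal_in G N ->
  N = [set 1] \/ exists n, N `<=` @level_stab _ n /\ ~ N `<=` @level_stab _ n.+1.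
Proof.
move=> [sN _ _]; have [[n NSn]|all] := pselect (exists n, ~ N `<=` @level_stab 'F_p n); last first.
  left; rewrite eqEsubset; split=> [x Nx|_ ->]; last exact: (subgroup1 sN).
  apply: level_stab_eq1 => n; apply: contrapT => xS.
  by apply: all; exists n => /(_ x Nx).
right; elim: n NSn => [|n IH] NSn.
  by case: NSn => x _ [|//] _; apply: act_root.
by have [NS|/IH//] := pselect (N `<=` @level_stab 'F_p n); exists n.
Qed.

(** The layers reduce [N] to [N'] modulo the normal closure of [s]. Applying [sections_in_commg] to
    that normal closure, instead of [N], absorbs [N']. *)
Lemma sunic_generate N : normal_in G N ->
  exists s : seq (autT 'F_p), (size s <= width)%N /\ normal_closure G [set` s] = N.
Proof.
move=> nN; have [->|[n [NS NNS]]] := sunic_normal_level nN.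
  exists [::]; split=> //.
  rewrite (_ : [set` [::]] = set0); last by rewrite eqEsubset; split.
  exact: normal_closure0.
have [N' lN' N'P] := sunic_layers nN NS.
have [s [sk sN gens]] := layers_generate sG nN lN'.
exists s; split; first by rewrite sk.
have [sNN NG _] := nN; have sub : [set` s] `<=` N by move=> v /= /sN.
have nQ : normal_in G (normal_closure G [set` s]).
  by apply: (normal_closure_normal sG) => v /sub/NG.
have QN : normal_closure G [set` s] `<=` N by apply: normal_closure_min.
rewrite eqEsubset; split=> // x Nx; have [sQ _ _] := nQ.
(* The normal closure moves level [n.+1] because [N] does and [N'] does not. *)
have QS : ~ normal_closure G [set` s] `<=` @level_stab _ n.+1.
  move=> QS; apply: NNS => z Nz; have [y Qy /N'P[zS _]] := gens z Nz.
  rewrite -[z](mulVKg y); apply: (subgroupM (level_stab_subgroup _ _)); first exact: QS.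
  exact: level_stab_le zS.
have [y Qy /N'P[zS zK]] := gens x Nx.
rewrite -[x](mulVKg y); apply: (subgroupM sQ) => //.
apply: (commg_group_sub nQ).
apply: (sections_in_commg pp r_gt0 f0 bP Gtrans branch_startP nQ _ QS zS zK).
by move=> z /QN/NS.
Qed.

Lemma sunic_cover N : normal_in G N ->
  exists s : seq (autT 'F_p), (size s <= p ^ width)%N /\
    forall x, N x -> exists2 d, d \in s & commg_group N G (d^-1 * x).
Proof.
move=> nN; have [sC _ _] := commg_group_normal sG nN.
have [->|[n [NS NNS]]] := sunic_normal_level nN.
  exists [:: 1]; split; first by rewrite expn_gt0 prime_gt0.
  move=> _ ->; exists 1; rewrite ?mem_head // mulVg.
  exact: (subgroup1 (gen_by_subgroup _)).
have [N' lN' N'P] := sunic_layers nN NS.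
have [s [sk _ cov]] := layers_cover sG nN lN'.
exists s; split=> // x Nx; have [d ds [y Cy /N'P[zS zK]]] := cov x Nx; exists d => //.
have -> : d^-1 * x = y * ((d * y)^-1 * x) by rewrite !gnorm.
apply: (subgroupM sC) => //.
exact: (sections_in_commg pp r_gt0 f0 bP Gtrans branch_startP nN NS NNS zS zK).
Qed.

End Chains.

(** * Congruence completion and the two bounds *)

Section Congruence.
Variable X : finType.
Implicit Types (A B : set (autT X)) (x y g : autT X).

Lemma coset_open x n : open [set x * g | g in @level_stab X n].
Proof.
suff h : autT_open [set x * g | g in @level_stab X n] by exact: h.
move=> _ [g gS <-]; exists n => _ [h hS <-]; exists (g * h); last by rewrite mulgA.
exact: (subgroupM (level_stab_subgroup X n)).
Qed.

Lemma closure_levelP A x :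
  closure A x <-> forall n, exists2 y, A y & level_stab n (x^-1 * y).
Proof.
split=> [Ax n|Ax U].
  have /Ax[y [Ay [g gS gy]]] : nbhs x [set x * g | g in @level_stab X n].
    apply: open_nbhs_nbhs; split; first exact: coset_open.
    by exists 1; [exact: (subgroup1 (level_stab_subgroup X n))|rewrite mulg1].
  by exists y; rewrite // -gy mulKg.
rewrite nbhsE => -[V [Vo Vx] VU].
have Vo' : autT_open V by exact: Vo.
have [n nV] := Vo' x Vx; have [y Ay yS] := Ax n.
by exists y; split=> //; apply: VU; apply: nV; exists (x^-1 * y); rewrite ?mulVKg.
Qed.

Lemma closure_subgroup A : is_subgroup A -> is_subgroup (closure A).
Proof.
move=> sA; split; first by apply: subset_closure; apply: (subgroup1 sA).
move=> x y /closure_levelP Ax /closure_levelP Ay; apply/closure_levelP => n.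
have [x' Ax' xS] := Ax n; have [y' Ay' yS] := Ay n; exists (x' * y'^-1).
  exact: sA.2.
have sS := level_stab_subgroup X n.
have -> : (x * y^-1)^-1 * (x' * y'^-1) = (x^-1 * x') ^ y^-1 * ((y^-1 * y')^-1 ^ y^-1).
  by rewrite /conjg !gnorm.
by apply: (subgroupM sS); apply: level_stabJ => //; apply: (subgroupV sS).
Qed.

(** Otherwise each of the finitely many [d] fails at some level; an approximation of [x] in [A] up
    to the largest of these levels contradicts the cover. *)
Lemma closure_cover (s : seq (autT X)) A B :
    (forall x, A x -> exists2 d, d \in s & B (d^-1 * x)) ->
  forall x, closure A x -> exists2 d, d \in s & closure B (d^-1 * x).
Proof.
move=> cov x /closure_levelP Ax; apply: contrapT => none.
have bad d : d \in s -> exists n, forall y, B y -> ~ level_stab n ((d^-1 * x)^-1 * y).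
  move=> ds; apply: contrapT => nobad; apply: none; exists d => //.
  apply/closure_levelP => n; apply: contrapT => nB; apply: nobad; exists n => y By yS.
  by apply: nB; exists y.
have [m mP] : exists m, forall d, d \in s ->
    forall y, B y -> ~ level_stab m ((d^-1 * x)^-1 * y).
  elim: s bad {cov none} => [|d s IH] bad; first by exists 0%N.
  have [|m mP] := IH; first by move=> e es; apply: bad; rewrite in_cons es orbT.
  have [k kP] := bad d (mem_head _ _); exists (maxn m k) => e.
  rewrite in_cons => /predU1P[->|es] y By yS.
    by apply: (kP y By); apply: level_stab_le yS; rewrite leq_maxr.
  by apply: (mP e es y By); apply: level_stab_le yS; rewrite leq_maxl.
have [y Ay yS] := Ax m; have [d ds By] := cov y Ay.
by apply: (mP d ds _ By); rewrite invgM invgK -mulgA mulVKg.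
Qed.

Lemma open_sub_closure A B x U : open U -> closure A x -> U x -> closure (A `&` U) x.
Proof.
move=> Uo /closure_levelP Ax Ux; have Uo' : autT_open U by exact: Uo.
have [m mU] := Uo' x Ux; apply/closure_levelP => n.
have [y Ay yS] := Ax (maxn m n); exists y; last first.
  by apply: level_stab_le yS; rewrite leq_maxr.
split=> //; apply: mU; exists (x^-1 * y); last by rewrite mulVKg.
by apply: level_stab_le yS; rewrite leq_maxl.
Qed.

End Congruence.

Lemma right_cosets_le (gT : groupType) (H K : set gT) (s : seq gT) (R : realType) :
    is_subgroup H -> is_subgroup K ->
    (forall h, H h -> exists2 d, d \in s & K (d^-1 * h)) ->
  (group_index R H K <= (size s)%:R%:E)%E.
Proof.
move=> sH sK cov.
have cosets_le : (right_cosets H K #<= `I_(size s))%card.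
  pose F i := [set k * (nth 1 s i)^-1 | k in K].
  apply: (card_le_trans _ (card_image_le F _)); apply: subset_card_le => _ [h Hh <-].
  (* The cover is by left cosets; inverting [h] turns them into right cosets. *)
  have [d ds Kd] := cov _ (subgroupV sH Hh); exists (index d s); first by rewrite /= index_mem.
  rewrite /F nth_index // eqEsubset; split=> _ [k Kk <-].
    exists (k * (d^-1 * h^-1)); first exact: (subgroupM sK).
    by rewrite !gnorm.
  exists (k * (d^-1 * h^-1)^-1); last by rewrite !gnorm.
  exact: sK.2.
have fin : finite_set (right_cosets H K) by apply/finite_set_leP; exists (size s).
rewrite /group_index /counting asboolT // lee_fin ler_nat.
exact: geq_card_fset_set.
Qed.

Lemma elogb_le (R : realType) p k (x : \bar R) : (1 < p)%N -> (x <= (p ^ k)%:R%:E)%E ->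
  (elogb p x <= k%:R%:E)%E.
Proof.
move=> p1 xp; have p0 : (0 < p%:R :> R)%R by rewrite ltr0n; lia.
have lnp : (0 < ln (p%:R : R))%R by rewrite ln_gt0 // ltr1n.
have lnpV : (0 < (ln (p%:R : R))^-1)%R by rewrite invr_gt0.
have [x0|x0] := leP x 0%E.
  by rewrite /elogb le0_lneNy // mulNyr gtr0_sg // mul1e leNye.
rewrite /elogb.
have pk0 : (0 < (p ^ k)%:R :> R)%R by rewrite ltr0n expn_gt0; lia.
have le_ln : (lne x <= (k%:R * ln (p%:R : R))%:E)%E.
  have -> : (k%:R * ln (p%:R : R))%:E = lne ((p ^ k)%:R%:E).
    by rewrite lne_EFin // natrX lnXn // mulr_natl.
  by rewrite lee_lne // in_itv /= leey andbT ?ltW // lee_fin ltW.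
apply: (le_trans (lee_wpmul2r _ le_ln)); first by rewrite lee_fin ltW.
by rewrite -EFinM mulfK // gt_eqF.
Qed.

Section Bounds.
Variables (R : realType) (p r : nat) (f : {poly 'F_p}) (b : nat -> autT 'F_p).
Hypothesis pp : prime p.
Hypothesis r_gt0 : (0 < r)%N.
Hypothesis f0 : (f`_0 != 0)%R.
Hypothesis bP : directed_system r f b.

Local Notation G := (sunic_group r b).

Hypothesis Gtrans : level_transitive G.
Hypothesis r_gt1 : p = 2%N -> (1 < r)%N.

Lemma sunic_normal_rank : (normal_rank R G <= (width p r)%:R%:E)%E.
Proof.
apply: ge_ereal_sup => _ [N [nN _] <-].
have [s [sk <-]] := sunic_generate pp r_gt0 f0 bP Gtrans r_gt1 nN.
apply: (@le_trans _ _ (size s)%:R%:E); last by rewrite lee_fin ler_nat.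
by apply: ereal_inf_lbound; exists s.
Qed.

Lemma sunic_central_width : (central_width R p (closure G) <= (width p r)%:R%:E)%E.
Proof.
have sG := sunic_subgroup r b; have G_cl : G `<=` closure G := @subset_closure _ G.
apply: ge_ereal_sup => _ [Del [[sD DcG nD] [U Uo DE]] <-].
have nD0 : normal_in G (G `&` Del).
  split; [exact: subgroupI|by move=> x []|move=> g x Gg [Gx Dx]].
  by split; [exact: (subgroupJ sG)|apply: nD => //; apply: G_cl].
have [s [sk cov]] := sunic_cover pp r_gt0 f0 bP Gtrans r_gt1 nD0.
have comm_le : commg_group (G `&` Del) G `<=` gen_by (commutators Del (closure G)).
  by apply: commg_group_mono G_cl => x [].
apply: elogb_le; first exact: prime_gt1.
apply: (@le_trans _ _ (size s)%:R%:E); last by rewrite lee_fin ler_nat.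
apply: right_cosets_le => // [|h Dh].
  exact/closure_subgroup/gen_by_subgroup.
have [Gh Uh] : closure G h /\ U h by move: Dh; rewrite DE => -[].
(* [Del] is relatively open in the closure of [G], so its points are limits of points of [G] inside
   [Del]. *)
have D0h : closure (G `&` Del) h.
  have : closure (G `&` U) h by apply: open_sub_closure.
  by apply: closure_subset => x [Gx Ux]; split=> //; rewrite DE; split=> //; apply: G_cl.
have [d ds Cd] := closure_cover cov D0h; exists d => //.
exact: closure_subset comm_le _ Cd.
Qed.

End Bounds.

Theorem theorem1p6 (R : realType) (p r : nat) (f : {poly 'F_p})
    (b : nat -> autT 'F_p) :
  prime p ->
  (0 < r)%N -> size f = r.+1 -> f \is monic -> (f`_0 != 0)%R ->
  directed_system r f b ->
  let G := sunic_group r b in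
  regular_branch G ->
  (odd p ->
     (normal_rank R G <= (r + 3)%:R%:E)%E /\
     (central_width R p (closure G) <= (r + 3)%:R%:E)%E) /\
  (p = 2%N ->
     forall n : nat, (0 < n)%N ->
     gen_by ([set sunic_a p] `|` [set b i | i in [set i | (0 < i < r)%N]])
       `<=` section (last_vertex p n) @`
              (sunic_K r b `&` stab (last_vertex p n)) ->
     (normal_rank R G <= (r + n + 3)%:R%:E)%E /\
     (central_width R p (closure G) <= (r + n + 3)%:R%:E)%E).
Proof.
move=> pp r_gt0 _ _ f0 bP G [L [_ [Gtrans _ _]]].
split=> [op|p2 n n0 secs].
  have r1 : p = 2%N -> (1 < r)%N by move=> p2; rewrite p2 in op.
  have -> : (r + 3)%N = width p r by rewrite /width op; lia.
  split; first exact: (sunic_normal_rank R pp r_gt0 f0 bP Gtrans r1).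
  exact: (sunic_central_width R pp r_gt0 f0 bP Gtrans r1).
have r1 : (1 < r)%N.
  (* For [r = 1] the group [sunic_K] is trivial. *)
  rewrite ltnNge; apply/negP => r_le1.
  have K1 : sunic_K r b = [set 1].
    rewrite /sunic_K (_ : [set _ | _ in _] = set0); last first.
      by rewrite eqEsubset; split=> // t [i /= ir _]; lia.
    exact/normal_closure0/sunic_subgroup.
  (* A preimage of [a] would be trivial, forcing [a = 1], but [a] moves the letter [0]. *)
  have [|x [Kx _] xa] := secs (sunic_a p).
    by apply: sub_gen_by; left.
  move: Kx; rewrite K1 => x1; move: xa; rewrite x1 section1 => a1.
  have := act_a (p := p) 0%R [::]; rewrite -a1 addr0 => -[/eqP].
  by rewrite eq_sym oner_eq0.
(* Here [width] is [r + 4], and [n] is at least [1]. *)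
have wE : (width p r <= r + n + 3)%N by rewrite /width p2 /=; lia.
have wR : ((width p r)%:R%:E <= (r + n + 3)%:R%:E :> \bar R)%E by rewrite lee_fin ler_nat.
split; apply: le_trans wR.
  exact: (sunic_normal_rank R pp r_gt0 f0 bP Gtrans (fun _ => r1)).
exact: (sunic_central_width R pp r_gt0 f0 bP Gtrans (fun _ => r1)).
Qed.
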